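(* Let $X(t)=\sum_i\beta_i g(t-\tau_i)$, $t\in\mathbb{R}$, be a stationary shot noise process with Poisson intensity $\lambda$ and a $C^\infty(\mathbb{R})$ kernel $g$ such that, for some $\alpha>0$ and every $k\ge1$, $$g^{(k)}(t)\simeq c_k(t)e^{\alpha t}\ \text{ as } t\to-\infty\quad\text{and}\quad g^{(k)}(t)\simeq C_k(t)e^{-\alpha t}\ \text{ as } t\to+\infty,$$ where $\simeq$ means equivalence and $c_k,C_k$ are polynomials of arbitrary degree. Assume furthermore that $\lambda>\alpha$ and $\mathbf{E}(|\beta_1|)<\infty$. If in addition either (i) $\beta_1$ has a bounded density, or (ii) $\mathbf{E}(1/|\beta_1|)<\infty$ and $x\mapsto g(x)$, or $x\mapsto g(-x)$, has a strictly negative derivative on $(0,+\infty)$, then $\mathbf{E}(N_u^p)<\infty$ for any $p\ge1$, where $N_u=\#\{t\in I:X(t)=u\}$ for $u\in\mathbb{R}$ and a bounded interval $I\subset\mathbb{R}$.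
   Context: In the shot noise process, $(\beta_i)$ (the impulses) is a sequence of i.i.d. integrable random variables, $(\tau_i)$ is a Poisson field on $\mathbb{R}$ with constant intensity $\lambda>0$, independent of $(\beta_i)$, and the kernel $g:\mathbb{R}\to\mathbb{R}$ belongs to $L^1(\mathbb{R})$. Equivalence $f_1(t)\simeq f_2(t)$ means that $f_1(t)/f_2(t)\to1$. *)

(* Defs.v *)
From HB Require Import structures.
From mathcomp Require Import all_boot all_order all_algebra finmap.
From mathcomp Require Import all_classical all_reals all_analysis.
From mathcomp Require Import measurable_realfun.

Set Implicit Arguments.
Unset Strict Implicit.
Unset Printing Implicit Defensive.

Import Order.TTheory GRing.Theory Num.Theory.
Import numFieldNormedType.Exports.

Local Open Scope classical_set_scope.
Local Open Scope ring_scope.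

Definition mutually_independent (R : realType) (d : measure_display)
    (T : measurableType d) (P : probability T R) (I : choiceType)
    (E : I -> set (set T)) : Prop :=
  forall (J : {fset I}) (A : I -> set T), (forall i, i \in J -> E i (A i)) ->
    P (\bigcap_(i in [set` J]) A i) = (\prod_(i <- J) P (A i))%E.

Definition sigma_of_sequence (R : realType) (d : measure_display)
    (T : measurableType d) (X : nat -> T -> R) : set (set T) :=
  <<s \bigcup_i g_sigma_algebra_preimage (X i) >>.

Definition independent_sequences (R : realType) (d : measure_display)
    (T : measurableType d) (P : probability T R) (X Y : nat -> T -> R) : Prop :=
  forall A B : set T, sigma_of_sequence X A -> sigma_of_sequence Y B ->
    P (A `&` B) = (P A * P B)%E.

Definition iid (R : realType) (d : measure_display) (T : measurableType d)
    (P : probability T R) (X : nat -> {RV P >-> R}) : Prop :=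
  mutually_independent P (fun i => g_sigma_algebra_preimage (X i)) /\
  (forall i (A : set R), measurable A ->
     distribution P (X i) A = distribution P (X 0%N) A).

(* Points are counted with multiplicity; the value is +oo when infinitely many
   of them lie in A. *)
Definition point_count (R : realType) (T : Type) (tau : nat -> T -> R)
    (A : set R) (w : T) : \bar R :=
  counting [set i | A (tau i w)].

(* poisson_prob r k is the Poisson law of parameter r (the Dirac mass at 0 when
   r = 0); it does not depend on its argument k. *)
Definition poisson_field (R : realType) (d : measure_display)
    (T : measurableType d) (P : probability T R) (lambda : R)
    (tau : nat -> {RV P >-> R}) : Prop :=
  (forall A : set R, measurable A -> (lebesgue_measure A < +oo)%E ->
     forall k : nat,
       P [set w | point_count tau A w = k%:R%:E] =
       poisson_prob (lambda * fine (lebesgue_measure A)) k [set k]) /\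
  (forall (n : nat) (A : 'I_n -> set R),
     (forall i, measurable (A i)) -> trivIset setT A ->
     mutually_independent P
       (fun i => g_sigma_algebra_preimage (point_count tau (A i)))).

(* Under the hypotheses g in L^1, E|beta| < oo the series converges absolutely
   almost surely, so the enumeration of the points is immaterial. *)
Definition shot_noise (R : realType) (T : Type) (beta tau : nat -> T -> R)
    (g : R -> R) (t : R) (w : T) : R :=
  limn (series (fun i => beta i w * g (t - tau i w))).

Definition smooth (R : realType) (g : R -> R) : Prop :=
  forall (n : nat) (t : R), derivable (g^`(n))%classic t 1.

Definition equivalent_at (R : realType) (F : set_system R) (f1 f2 : R -> R) :
    Prop :=
  f1 t / f2 t @[t --> F] --> (1 : R).

Definition has_bounded_density (R : realType) (d : measure_display)
    (T : measurableType d) (P : probability T R) (X : {RV P >-> R}) : Prop :=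
  exists f : R -> R,
    [/\ measurable_fun setT f,
        forall x, 0 <= f x,
        exists M : R, forall x, f x <= M
      & forall A : set R, measurable A ->
          distribution P X A = (\int[lebesgue_measure]_(x in A) (f x)%:E)%E].

Definition crossings (R : realType) (T : Type) (X : R -> T -> R) (I : set R)
    (u : R) (w : T) : \bar R :=
  counting [set t | I t /\ X t w = u].

Arguments iid {R d T} P X.
Arguments poisson_field {R d T} P lambda tau.
Arguments has_bounded_density {R d T} P X.

(* Main.v *)
Require Import Defs.
From HB Require Import structures.
From mathcomp Require Import all_boot all_order all_algebra finmap.
From mathcomp Require Import all_classical all_reals all_analysis.
From mathcomp Require Import measurable_realfun ring lra.

(** Let X be the shot noise and let V be the total mark, the sum over i of
    |beta_i| exp (- alpha / 4 * |tau_i|).  The theorem combines a regularity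
    estimate for X with a small ball estimate for X t.

    Regularity.  X is never differentiated.  If X = u at m points of [a, b],
    interpolate each translate g (. - tau_i) at these m points: Lagrange
    interpolation is linear in the interpolated function, so the error bounds
    of the translates add up to |X a - u| <= K (b - a)^m V
    ([interpolation_error], [many_crossings]).  The exponential equivalents make
    g and all its derivatives O(exp (- alpha / 2 * |t|)) ([kernel_decay]), and V
    is integrable by Campbell's formula ([mean_total_mark]).

    Small balls.  There is C such that |X t - u| <= s^8 has probability at most
    C s, uniformly in t ([concentration]).  Only a window of length
    l = 1 + (2 / alpha) ln (1 / s) is looked at: it lies where g' is bounded
    below by a multiple of s^2, and it contains no point with probability
    exp (- lambda l) <= s^2, because lambda > alpha.  Cut the line into
    small cells of length h.  The numbers of points in the cells are independent
    Poisson variables; given these numbers, the law of the sum X t with g frozen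
    on each cell does not depend on the enumeration of the points, because the
    marks are i.i.d. and independent of the points ([lincomb_law]).  A
    configuration with exactly one point in a cell weighs lambda h times the
    configuration where this point is erased; this is a discrete form of Mecke's
    formula, and it bounds the probability that one cell of the window holds a
    single point while the sum hits a ball by lambda h times the supremum over Y
    of the sum over k of P(|beta g(t - x_k) + Y - u| <= e)
    ([prob_grid_sum_hit]).  For a fixed value b of beta the numbers
    b g(t - x_k) are separated, so few of them meet the ball unless |b| is small
    ([sum_small_ball]).  The two alternatives on the law of beta both give
    P(|beta| <= rho) <= K rho ([small_ball]).

    Conclusion.  Cut the interval into n pieces.  If it contains m n crossings,
    one piece contains m of them, and then either V is large or X is very close
    to u at the left end of that piece.  Taking m large gives
    P(N >= m n) <= C / (n + 1)^k for every k ([crossings_tail]), hence all the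
    moments.  The integral of a nonnegative function is a supremum over simple
    functions below it, hence monotone even where measurability is unknown
    ([le_lower_integral]), so it is enough to dominate N^p by a measurable
    function. *)

Set Implicit Arguments.
Unset Strict Implicit.
Unset Printing Implicit Defensive.

Import Order.TTheory GRing.Theory Num.Theory.
Import numFieldNormedType.Exports.

Local Open Scope classical_set_scope.
Local Open Scope ring_scope.

(** Unlike [ge0_le_integral], this applies to functions not known to be
    measurable, such as the number of crossings. *)
Lemma le_lower_integral {R : realType} {d : measure_display}
    {T : measurableType d} (mu : {measure set T -> \bar R}) (f1 f2 : T -> \bar R) :
  (forall x, (0 <= f1 x)%E) -> (forall x, (f1 x <= f2 x)%E) ->
  (\int[mu]_x f1 x <= \int[mu]_x f2 x)%E.
Proof.
move=> f10 f12.
have f20 x : (0 <= f2 x)%E by exact: le_trans (f12 x).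
rewrite !ge0_integralTE//; apply: le_ereal_sup => _ [h hf1 <-].
by exists h => // x; exact: le_trans (f12 x).
Qed.

(** * Linear combinations of i.i.d. marks *)

Section law_of_combinations.
Context {R : realType} {d : measure_display} {T : measurableType d}.
Variable P : probability T R.

(** The event E carries the independence from further marks through the
    induction of [lincomb_law]. *)
Lemma pair_law (X Y : {RV P >-> R}) (E : set T) : measurable E ->
  (forall A B : set R, measurable A -> measurable B ->
    P (E `&` (X @^-1` A `&` Y @^-1` B)) =
    (P E * (P (X @^-1` A) * P (Y @^-1` B)))%E) ->
  forall D : set (R * R), measurable D ->
    P (E `&` [set w | D (X w, Y w)]) =
    (P E * (distribution P X \x distribution P Y) D)%E.
Proof.
move=> mE EXY D mD.
have PEf : P E \is a fin_num by exact: fin_num_measure.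
have e0 : 0 <= fine (P E) by exact: fine_ge0.
have eE : P E = (fine (P E))%:E by rewrite fineK.
pose m2 := mscale (NngNum e0) (distribution P Y).
have mXY : measurable_fun setT (fun w => (X w, Y w)) by exact/measurable_fun_pair.
pose m' := pushforward (mrestr P mE) (fun w => (X w, Y w)).
have h : (distribution P X \x m2)%E D = m' D.
  apply: product_measure_unique => //= A B mA mB.
  rewrite /m' /pushforward /mrestr /m2 /mscale /=.
  transitivity (P (E `&` (X @^-1` A `&` Y @^-1` B))); first by rewrite setIC.
  rewrite EXY// eE /distribution /pushforward muleCA. done.
transitivity (m' D); first by rewrite /m' /pushforward /mrestr setIC.
rewrite -h /product_measure1/= eE -ge0_integralZl//; first exact: measurable_fun_xsection.
Qed.
Definition lincomb (beta : nat -> T -> R) (s : seq R) (J : seq nat) (w : T) : R :=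
  \sum_(p <- zip s J) p.1 * beta p.2 w.

Variable beta : nat -> {RV P >-> R}.
Hypothesis beta_iid : iid P beta.

Lemma measurable_lincomb s J : measurable_fun setT (lincomb beta s J).
Proof.
apply: measurable_sum => p.
by apply: measurable_funM => //; exact: measurable_cst.
Qed.

Lemma beta_preimage_measurable i (A : set R) : measurable A ->
  measurable (beta i @^-1` A).
Proof. by move=> mA; rewrite -[X in measurable X]setTI; exact: measurable_funPT. Qed.

(** A linear combination of distinct marks is independent of the remaining
    ones, and its law depends on the coefficients only, not on which marks
    are used.  Both facts are proved together because each step of the induction
    peels off one mark and needs its independence from the rest of the sum. *)
Lemma lincomb_law s : forall J J' (F : {fset nat}) (A : nat -> set R) (B : set R),
  size J = size s -> size J' = size s -> uniq J -> uniq J' ->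
  (forall i, i \in F -> i \notin J) ->
  (forall i, measurable (A i)) -> measurable B ->
  P (\bigcap_(i in [set` F]) (beta i @^-1` A i) `&` lincomb beta s J @^-1` B) =
  (P (\bigcap_(i in [set` F]) (beta i @^-1` A i)) *
   P (lincomb beta s J' @^-1` B))%E.
Proof.
have mE (F : {fset nat}) (A : nat -> set R) : (forall i, measurable (A i)) ->
    measurable (\bigcap_(i in [set` F]) (beta i @^-1` A i)).
  move=> mA; apply: fin_bigcap_measurable => //.
  by move=> i _; exact: beta_preimage_measurable.
elim: s => [|x s IH] [|m J] // [|m' J'] // F A B.
  move=> _ _ _ _ _ mA mB.
  have [B0|B0] := pselect (B 0).
    rewrite (_ : lincomb _ _ _ @^-1` B = setT) ?setIT ?probability_setT ?mule1//.
    by apply/seteqP; split=> // w _; rewrite /lincomb/= big_nil.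
  rewrite (_ : lincomb _ _ _ @^-1` B = set0) ?setI0 ?measure0 ?mule0//.
  by apply/seteqP; split=> // w; rewrite /lincomb/= big_nil.
move=> [sJ] [sJ'] /andP[mJ uJ] /andP[mJ' uJ'] FJ mA mB.
pose Y K : {RV P >-> R} := mfun_Sub (mem_set (measurable_lincomb s K)).
pose D := [set z : R * R | B (x * z.1 + z.2)].
have mD : measurable D.
  rewrite -[D]setTI; apply: (_ : measurable_fun setT (fun z : R * R => x * z.1 + z.2)) => //.
  by apply: measurable_funD => //; apply: measurable_funM.
have combE K k w : lincomb beta (x :: s) (k :: K) w = x * beta k w + Y K w.
  by rewrite /lincomb/= big_cons.
have step (F' : {fset nat}) K k : size K = size s -> uniq K -> k \notin K ->
    (forall i, i \in F' -> i \notin k :: K) ->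
  P (\bigcap_(i in [set` F']) (beta i @^-1` A i) `&` lincomb beta (x :: s) (k :: K) @^-1` B) =
  (P (\bigcap_(i in [set` F']) (beta i @^-1` A i)) *
    (distribution P (beta k) \x distribution P (Y K)) D)%E.
  move=> sK uK kK F'K.
  rewrite (_ : _ @^-1` B = [set w | D (beta k w, Y K w)]); last first.
    by apply/seteqP; split=> w /=; rewrite combE.
  apply: pair_law => //; first exact: mE.
  move=> A1 B1 mA1 mB1.
  have kF' : k \notin F' by apply/negP => /F'K; rewrite inE eqxx.
  pose A' i := if i == k then A1 else A i.
  have mA' i : measurable (A' i) by rewrite /A'; case: ifP.
  have capE : \bigcap_(i in [set` (k |` F')%fset]) (beta i @^-1` A' i) =
    \bigcap_(i in [set` F']) (beta i @^-1` A i) `&` (beta k @^-1` A1).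
    rewrite set_fsetU set_fset1 bigcap_setU bigcap_set1 setIC /A' eqxx; congr (_ `&` _).
    apply: eq_bigcapr => i /= iF'; case: eqP => // ik.
    by move: kF'; rewrite -ik iF'.
  (* The event on the peeled mark joins the events indexed by F'. *)
  rewrite setIA -capE (IH K K)//; last first.
    move=> i; rewrite !inE => /orP[/eqP -> //|/F'K].
    by rewrite inE negb_or => /andP[].
  rewrite muleA; congr (_ * _)%E.
  case: beta_iid => indep _.
  have prodE (G : {fset nat}) (A0 : nat -> set R) : (forall i, measurable (A0 i)) ->
    P (\bigcap_(i in [set` G]) (beta i @^-1` A0 i)) = (\prod_(i <- G) P (beta i @^-1` A0 i))%E.
    move=> mA0; apply: indep => i _; rewrite /g_sigma_algebra_preimage /preimage_set_system/=.
    by exists (A0 i) => //; rewrite setTI.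
  rewrite !prodE// big_fsetU1//= {1}/A' eqxx muleC; congr (_ * _)%E.
  rewrite !big_seq; apply: eq_bigr => i iF'; rewrite /A'; case: eqP => // ik.
  by move: kF'; rewrite -ik iF'.
rewrite step//; congr (_ * _)%E.
have := step fset0 J' m' sJ' uJ' mJ'.
rewrite (_ : \bigcap_(i in _) _ = setT); last first.
  by rewrite set_fset0 bigcap_set0.
rewrite setTI probability_setT mul1e => -> //.
have eqlaw (C : set R) : measurable C -> P (lincomb beta s J @^-1` C) = P (lincomb beta s J' @^-1` C).
  move=> mC; have := IH J J' fset0 A C sJ sJ' uJ uJ'.
  rewrite set_fset0 bigcap_set0 setTI probability_setT mul1e; apply => //.
apply/esym/product_measure_unique => //= A1 B1 mA1 mB1.
rewrite product_measure1E//; congr (_ * _)%E.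
  by case: beta_iid => _ h; transitivity (distribution P (beta 0%N) A1); [exact: h | exact/esym/h].
exact: eqlaw.
Qed.

(** The marks are exchangeable: permuting coefficients amounts to permuting
    indices. *)
Lemma lincomb_perm (s s' : seq R) (B : set R) : perm_eq s s' -> measurable B ->
  P (lincomb beta s (iota 0 (size s)) @^-1` B) =
  P (lincomb beta s' (iota 0 (size s')) @^-1` B).
Proof.
move=> ss' mB.
have [Is pIs s'E] : exists2 Is, perm_eq Is (iota 0 (size s)) & s' = map (nth 0 s) Is.
  by apply/perm_iotaP; rewrite perm_sym.
have uIs : uniq Is by rewrite (perm_uniq pIs) iota_uniq.
have sIs : size Is = size s' by rewrite s'E size_map.
have := @lincomb_law s' Is (iota 0 (size s')) fset0 (fun=> setT) B sIs.
rewrite set_fset0 bigcap_set0 setTI probability_setT mul1e size_iota iota_uniq => <- //.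
congr (P _); apply/seteqP.
suff E w : lincomb beta s (iota 0 (size s)) w = lincomb beta s' Is w.
  by split=> w /=; rewrite E.
rewrite /lincomb s'E.
have -> : zip [seq nth 0 s i | i <- Is] Is = [seq (nth 0 s i, i) | i <- Is].
  by rewrite -{2}(map_id Is) zip_map.
rewrite big_map /= (perm_big _ pIs)/=.
have {1}-> : s = [seq nth 0 s i | i <- iota 0 (size s)].
  by rewrite -/(mkseq _ _) mkseq_nth.
by rewrite -{2}(map_id (iota 0 (size s))) zip_map big_map/=.

Qed.

Lemma lincomb_pad (s : seq R) k w :
  lincomb beta (s ++ nseq k 0) (iota 0 (size s + k)) w =
  lincomb beta s (iota 0 (size s)) w.
Proof.
rewrite /lincomb iotaD zip_cat ?size_iota// big_cat/= [X in _ + X]big1_seq ?addr0//.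
move=> [a b] /andP[_]/= abz.
have : a \in unzip1 (zip (nseq k (0 : R)) (iota (size s) k)).
  by apply/mapP; exists (a, b).
rewrite unzip1_zip ?size_nseq ?size_iota// mem_nseq => /andP[_ /eqP ->].
by rewrite mul0r.
Qed.

End law_of_combinations.

(** * Small balls for one mark *)

Section separated_values.
Context {R : realType} {d : measure_display} {T : measurableType d}.
Variable P : probability T R.

(** The numbers b * v k are spaced by more than rho * delta, so the indices
    that meet a ball of radius e span at most 2 e / (rho delta). *)
Lemma card_separated n (v : 'I_n -> R) (delta e b y u rho : R) :
  0 < delta -> 0 < rho -> 0 <= e -> rho < `|b| ->
  (forall i j : 'I_n, (i <= j)%N -> delta * (j%:R - i%:R) <= `|v j - v i|) ->
  #|[set k : 'I_n | `|b * v k + y - u| <= e]%SET|%:R <= 1 + 2 * e / (rho * delta).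
Proof.
move=> d0 r0 e0 rb sep.
set A := [set k : 'I_n | _]%SET.
have [A0|[i0 i0A]] := set_0Vmem A.
  by rewrite A0 cards0 addr_ge0// divr_ge0// ?mulr_ge0// ltW.
pose i := [arg min_(i < i0 in A) val i]%N.
pose j := [arg max_(i > i0 in A) val i]%N.
have [iA imin] : i \in A /\ forall k, k \in A -> (i <= k)%N.
  by rewrite /i; case: arg_minnP => // i1 i1A h; split.
have [jA jmax] : j \in A /\ forall k, k \in A -> (k <= j)%N.
  by rewrite /j; case: arg_maxnP => // i1 i1A h; split.
have ij : (i <= j)%N by exact: imin.
have cardA : (#|A| <= (j - i).+1)%N.
  rewrite -(size_iota i (j - i).+1) cardE -(size_map val).
  apply: uniq_leq_size; first by rewrite map_inj_uniq ?enum_uniq//; exact: val_inj.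
  move=> _ /mapP[k kA ->]; rewrite mem_enum in kA.
  rewrite mem_iota imin//= addnS ltnS subnKC//; exact: jmax.
apply: (@le_trans _ _ (1 + (j%:R - i%:R))).
  by rewrite -natrB// -(natrD _ 1) ler_nat add1n.
rewrite lerD2l ler_pdivlMr ?mulr_gt0//.
have := sep i j ij => sepij.
have bv : `|b| * `|v j - v i| <= 2 * e.
  rewrite -normrM.
  have -> : b * (v j - v i) = (b * v j + y - u) - (b * v i + y - u) by ring.
  apply: (le_trans (ler_normB _ _)).
  by move: iA jA; rewrite !inE => ? ?; lra.
apply: le_trans bv.
rewrite mulrCA mulrA [X in X <= _](_ : _ = rho * (delta * (j%:R - i%:R))); last by ring.
apply: ler_pM => //; rewrite ?mulr_ge0 ?subr_ge0 ?ler_nat// ltW//.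
Qed.

(** The bound is uniform in the tail s of the sum: for
    each outcome one counts the k that meet the ball, and this count is at most
    n, and at most the bound of [card_separated] when |beta 0| > rho. *)
Lemma sum_small_ball (beta : nat -> {RV P >-> R}) (s : seq R) n (v : 'I_n -> R)
    (delta e u rho : R) :
  0 < delta -> 0 < rho -> 0 <= e ->
  (forall i j : 'I_n, (i <= j)%N -> delta * (j%:R - i%:R) <= `|v j - v i|) ->
  (\sum_(k < n) P (lincomb beta (v k :: s) (iota 0 (size s).+1)
      @^-1` [set x | (`|x - u| <= e)%R]) <=
   n%:R%:E * P [set w | (`|beta 0%N w| <= rho)%R] +
   (1 + 2 * e / (rho * delta))%:E)%E.
Proof.
move=> d0 r0 e0 sep.
pose A k := lincomb beta (v k :: s) (iota 0 (size s).+1) @^-1` [set x | `|x - u| <= e].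
pose S := [set w | `|beta 0%N w| <= rho].
have mball : measurable [set x : R | `|x - u| <= e].
  rewrite (_ : [set _ | _] = `[u - e, u + e]%classic).
    exact: measurable_itv.
  by apply/seteqP; split=> x /=; rewrite in_itv/= ler_distl.
have mA k : measurable (A k).
  by rewrite /A -[X in measurable X]setTI; exact: measurable_lincomb.
have mS : measurable S.
  rewrite (_ : S = beta 0%N @^-1` `[- rho, rho]%classic).
    by rewrite -[X in measurable X]setTI; apply: measurable_funPT.
  by apply/seteqP; split=> x; rewrite /S/= in_itv/= ler_norml.
set C := 1 + _.
have C0 : 0 <= C by rewrite addr_ge0// divr_ge0// mulr_ge0// ltW.
rewrite (_ : (\sum_(k < n) _)%E = (\int[P]_w (\sum_(k < n) (\1_(A k) w)%:E))%E); last first.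
  rewrite ge0_integral_sum//=.
    by apply: eq_bigr => k _; rewrite integral_indic// setIT.
  by move=> k; exact/measurable_EFinP.
rewrite (_ : (n%:R%:E * P S + C%:E)%E = (\int[P]_w ((n%:R * \1_S w)%:E + C%:E))%E); last first.
  rewrite ge0_integralD//=.
  - rewrite integral_cst// [X in _ = (_ + _ * X)%E](probability_setT P) mule1; congr (_ + _)%E.
    under eq_integral do rewrite EFinM.
    rewrite ge0_integralZl//; last by exact/measurable_EFinP.
    by rewrite integral_indic// setIT.
  - by apply/measurable_EFinP; exact: measurable_funM.
apply: ge0_le_integral => //=.
- by move=> w _; apply: sume_ge0 => k _; rewrite lee_fin.
- by apply: emeasurable_sum => k; exact/measurable_EFinP.
- by apply: emeasurable_funD => //; apply/measurable_EFinP; exact: measurable_funM.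
move=> w _; rewrite sumEFin -EFinD lee_fin.
have -> : \sum_(k < n) \1_(A k) w = #|[set k : 'I_n | `|beta 0%N w * v k +
     lincomb beta s (iota 1 (size s)) w - u| <= e]%SET|%:R :> R.
  rewrite -sum1_card natr_sum [RHS]big_mkcond/=; apply: eq_bigr => k _.
  have AE : A k w = (`|beta 0%N w * v k + lincomb beta s (iota 1 (size s)) w - u| <= e) :> Prop.
    by rewrite /A/= /lincomb/= big_cons/= (mulrC (v k)).
  rewrite indicE inE; case: ifPn => h.
    by rewrite mem_set// AE.
  by rewrite memNset// AE; exact/negP.
have [Sw|Sw] := leP `|beta 0%N w| rho.
  rewrite indicE mem_set// mulr1; apply: (@le_trans _ _ n%:R); last by rewrite lerDl.
  by rewrite ler_nat (leq_trans (max_card _))// card_ord.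
rewrite indicE memNset ?mulr0 ?add0r; last by apply/negP; rewrite -ltNge.
exact: card_separated.
Qed.

(** A bounded density bounds the mass of [-rho, rho] by 2 M rho; a finite mean
    of 1 / |X| does it by Markov's inequality.  No atom at 0 is possible in the
    second case because the inverse of 0 is +oo. *)
Lemma small_ball (X : {RV P >-> R}) :
  has_bounded_density P X \/ (\int[P]_w (`|X w|%R%:E)^-1 < +oo)%E ->
  exists2 K : R, 0 <= K & forall rho : R, 0 < rho ->
    (P [set w | (`|X w| <= rho)%R] <= (K * rho)%:E)%E.
Proof.
have SE rho : [set w | `|X w| <= rho] = X @^-1` `[- rho, rho]%classic.
  by apply/seteqP; split=> x /=; rewrite in_itv/= ler_norml.
move=> [[f [mf f0 [M fM] fE]]|Xinv].
  exists (2 * `|M|); first by rewrite mulr_ge0.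
  move=> rho r0; rewrite SE -[leLHS]/(distribution P X `[- rho, rho]%classic) fE//.
  apply: (@le_trans _ _ (\int[lebesgue_measure]_(x in `[(- rho)%R, rho]%classic) (`|M|%:E))%E).
    apply: ge0_le_integral => //=.
    - by move=> x _; rewrite lee_fin.
    - exact/measurable_EFinP/measurable_funTS.
    - by move=> x _; rewrite lee_fin (le_trans (fM x))// ler_norm.
  rewrite integral_cst//= lebesgue_measure_itv/= lte_fin gtrN// -EFinD -EFinM lee_fin opprK.
  by rewrite [leLHS](_ : _ = 2 * `|M| * rho)//; ring.
have If : (\int[P]_w (`|X w|%R%:E)^-1)%E \is a fin_num.
  by rewrite ge0_fin_numE//; apply: integral_ge0 => w _; rewrite inve_ge0.
exists (fine (\int[P]_w (`|X w|%R%:E)^-1)%E).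
  by apply/fine_ge0/integral_ge0 => w _; rewrite inve_ge0.
move=> rho r0.
have mS : measurable [set w | `|X w| <= rho].
  by rewrite SE -[X in measurable X]setTI; apply: measurable_funPT.
rewrite EFinM fineK// muleC -lee_pdivrMl//.
rewrite -[X in (_ * P X)%E]setIT -integral_indic// -ge0_integralZl//=; last first.
- by rewrite lee_fin invr_ge0 ltW.
- exact/measurable_EFinP.
apply: le_lower_integral => w; rewrite -EFinM.
  by rewrite lee_fin mulr_ge0// invr_ge0 ltW.
have [Sw|Sw] := pselect (`|X w| <= rho); last first.
  by rewrite indicE memNset// mulr0 inve_ge0.
rewrite indicE mem_set// mulr1 inver; case: eqP => [_|/eqP X0]; first by rewrite leey.
by rewrite lee_fin lef_pV2 ?posrE// lt0r X0/=.
Qed.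
End separated_values.

(** * Finite covers and packings by events *)

Section finite_cover.
Context {R : realType} {d : measure_display} {T : measurableType d}.
Variable P : probability T R.

Let sum_indic (I : finType) (Q : pred I) (E : I -> set T) :
  (forall i, measurable (E i)) ->
  (\sum_(i | Q i) P (E i))%E = (\int[P]_w (\sum_(i | Q i) (\1_(E i) w)%:E))%E.
Proof.
move=> mE; under eq_integral do rewrite -big_filter.
rewrite ge0_integral_sum//=.
  rewrite big_filter; apply: eq_bigr => k _; by rewrite integral_indic// setIT.
by move=> k; exact/measurable_EFinP.
Qed.

Lemma prob_cover (I : finType) (Q : pred I) (E : I -> set T) (A : set T) :
  measurable A -> (forall i, measurable (E i)) ->
  (forall w, A w -> exists2 i, Q i & E i w) ->
  (P A <= \sum_(i | Q i) P (E i))%E.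
Proof.
move=> mA mE AE; rewrite sum_indic// -[X in (P X <= _)%E]setIT -integral_indic//.
apply: le_lower_integral => w; first by rewrite lee_fin.
rewrite sumEFin lee_fin indicE; case: (asboolP (A w)) => Aw; last first.
  by rewrite memNset// sumr_ge0.
have [i Qi Ei] := AE w Aw.
by rewrite mem_set// (bigD1 i)//= indicE mem_set// lerDl sumr_ge0.
Qed.

Lemma prob_pack (I : finType) (Q : pred I) (E : I -> set T) (A : set T) :
  measurable A -> (forall i, measurable (E i)) ->
  (forall i, Q i -> E i `<=` A) ->
  (forall i j w, E i w -> E j w -> i = j) ->
  (\sum_(i | Q i) P (E i) <= P A)%E.
Proof.
move=> mA mE EA Ed; rewrite sum_indic// -[X in (_ <= P X)%E]setIT -integral_indic//.
apply: le_lower_integral => w; first by rewrite sumEFin lee_fin sumr_ge0.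
rewrite sumEFin lee_fin.
have [[i Qi Ei]|nE] := pselect (exists2 i, Q i & E i w).
  rewrite (bigD1 i)//= big1 ?addr0.
    by rewrite !indicE mem_set// mem_set//; exact: EA Ei.
  move=> j /andP[_ ji]; rewrite indicE memNset// => Ej.
  by move: ji; rewrite (Ed j i w)// eqxx.
rewrite big1// => i Qi; rewrite indicE memNset// => Ei.
by apply: nE; exists i.
Qed.

End finite_cover.

(** * Events generated by a sequence *)

Section sigma_of_sequence.
Context {R : realType} {d : measure_display} {T : measurableType d}.
Variable X : nat -> T -> R.

Let TX := g_sigma_algebraType (\bigcup_i g_sigma_algebra_preimage (X i)).

Let mX i : measurable_fun (setT : set TX) (X i).
Proof.
move=> _ B mB; rewrite setTI; apply: sub_sigma_algebra; exists i => //.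
by exists B => //; rewrite setTI.
Qed.

(** Membership in the generated sigma-algebras, rather than measurability
    alone, is what the independence of marks and points is stated for. *)
Lemma sigma_lincomb (s : seq R) (J : seq nat) (B : set R) : measurable B ->
  sigma_of_sequence X (lincomb X s J @^-1` B).
Proof.
move=> mB.
have mc : measurable_fun (setT : set TX) (lincomb X s J).
  apply: measurable_sum => p.
  by apply: measurable_funM => //; exact: measurable_cst.
by have := mc measurableT B mB; rewrite setTI.
Qed.

Lemma sigma_preimage i (B : set R) : measurable B ->
  sigma_of_sequence X (X i @^-1` B).
Proof. by move=> mB; have := @mX i measurableT B mB; rewrite setTI. Qed.

Lemma sigma_capI (E F : set T) : sigma_of_sequence X E -> sigma_of_sequence X F ->
  sigma_of_sequence X (E `&` F).
Proof. exact: (@measurableI _ TX). Qed.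

Lemma sigma_bigcap (E : nat -> set T) (D : set nat) :
  (forall i, sigma_of_sequence X (E i)) ->
  sigma_of_sequence X (\bigcap_(i in D) E i).
Proof. by move=> mE; apply: (@bigcap_measurableType _ TX) => // i _; exact: mE. Qed.

Lemma sigma_bigcap_fin (I : finType) (E : I -> set T) :
  (forall i, sigma_of_sequence X (E i)) ->
  sigma_of_sequence X (\bigcap_i E i).
Proof.
move=> mE; apply: (@fin_bigcap_measurable _ TX) => [|i _]; last exact: mE.
exact: finite_finset.
Qed.

End sigma_of_sequence.

(** * Poisson counts in finitely many cells *)

Lemma point_count_series {R : realType} {T : Type} (tau : nat -> T -> R) (A : set R) w :
  point_count tau A w = (\sum_(0 <= i <oo) (\1_A (tau i w))%:E)%E.
Proof.
rewrite /point_count counting_dirac; apply: eq_eseriesr => i _.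
by rewrite diracE indicE; congr (_ %:R%:E); apply/idP/idP; rewrite !inE.
Qed.

Lemma measurable_point_count {R : realType} {d : measure_display}
    {T : measurableType d} {P : probability T R} (tau : nat -> {RV P >-> R})
    (A : set R) : measurable A ->
  measurable_fun setT (point_count tau A).
Proof.
move=> mA; rewrite (_ : point_count tau A =
    fun w => (\sum_(0 <= i <oo) (\1_A (tau i w))%:E)%E).
  apply: ge0_emeasurable_sum => [i w _ _|i _]; first by rewrite lee_fin.
  by apply/measurable_EFinP; apply: measurableT_comp.
by apply/funext => w; exact: point_count_series.
Qed.

Section poisson_cells.
Context {R : realType} {d : measure_display} {T : measurableType d}.
Variable P : probability T R.
Variables beta tau : nat -> {RV P >-> R}.
Variable lambda : R.
Hypothesis lambda0 : 0 < lambda.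
Hypothesis beta_iid : iid P beta.
Hypothesis tau_poisson : poisson_field P lambda tau.
Hypothesis beta_tau_indep : independent_sequences P beta tau.

Variables (K : nat) (A : 'I_K -> set R) (h : R).
Hypothesis mA : forall k, measurable (A k).
Hypothesis tA : trivIset setT A.
Hypothesis h0 : 0 < h.
Hypothesis Ah : forall k, lebesgue_measure (A k) = h%:E.

Let r := lambda * h.
Let r0 : 0 < r. Proof. exact: mulr_gt0. Qed.

Lemma prob_count (k : 'I_K) (m : nat) :
  P [set w | point_count tau (A k) w = m%:R%:E] = (poisson_pmf r m)%:E.
Proof.
have [h1 _] := tau_poisson; rewrite h1 ?Ah ?ltry//=.
by rewrite /poisson_prob -/r r0 esum_set1// lee_fin poisson_pmf_ge0.
Qed.

(** A selection of the cells is again a finite disjoint family, which is what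
    the independence of the counts is stated for. *)
Lemma counts_independent (n : nat) (f : 'I_n -> 'I_K) (B : 'I_n -> set (\bar R)) :
  injective f -> (forall i, measurable (B i)) ->
  P (\bigcap_i (point_count tau (A (f i)) @^-1` B i)) =
  (\prod_i P (point_count tau (A (f i)) @^-1` B i))%E.
Proof.
move=> finj mB.
have [_ h2] := tau_poisson.
have tf : trivIset setT (A \o f).
  by move=> i j _ _ ij; apply: finj; exact: tA ij.
have := h2 n (A \o f) (fun i => mA (f i)) tf [fset i in 'I_n]%fset
  (fun i => point_count tau (A (f i)) @^-1` B i).
move=> hh.
have JT : [set` [fset i in 'I_n]%fset] = [set: 'I_n].
  by apply/seteqP; split=> i //= _; rewrite !inE.
rewrite JT in hh.
rewrite hh; last first.
  move=> i _; rewrite /g_sigma_algebra_preimage/preimage_set_system /=.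
  by exists (B i) => //; rewrite setTI.
apply: perm_big; apply: uniq_perm; rewrite ?fset_uniq ?index_enum_uniq// => i.
by rewrite mem_index_enum !inE.
Qed.

Definition cell (x : R) : option 'I_K := [pick k | `[< A k x >]].

Lemma cellP x k : (cell x == Some k) = `[< A k x >].
Proof.
rewrite /cell; case: pickP => [k' Ak'|nA]; last by rewrite nA.
apply/eqP/asboolP => [[<-]|Akx]; first exact/asboolP.
have [//|kk'] := eqVneq k' k; first by move=> ->.
by move: (tA (I : setT k') (I : setT k)) => ->//; exists x; split => //; apply/asboolP.
Qed.

Variable L : nat.
(** On this event the first L points determine the counts of all the cells. *)
Definition no_late : set T := [set w | forall i, (L <= i)%N -> cell (tau i w) = None].
Definition pattern_of (w : T) : {ffun 'I_L -> option 'I_K} := [ffun i : 'I_L => cell (tau i w)].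
Definition occupancy (q : {ffun 'I_L -> option 'I_K}) (k : 'I_K) : nat := #|[set i | q i == Some k]%SET|.

Lemma count_no_late w k : no_late w ->
  point_count tau (A k) w = (occupancy (pattern_of w) k)%:R%:E :> \bar R.
Proof.
move=> nl; rewrite /point_count.
have -> : [set i | A k (tau i w)] = [set` [fset val i | i in [set i | pattern_of w i == Some k]%SET]%fset].
  apply/seteqP; split=> i /=.
    move=> Aki; have iL : (i < L)%N.
      rewrite ltnNge; apply/negP => Li; have := nl i Li.
      by move=> /eqP; apply/negP; rewrite (_ : cell _ = Some k)//; apply/eqP; rewrite cellP; apply/asboolP.
    apply/imfsetP; exists (Ordinal iL) => //=.
    by rewrite inE ffunE/= cellP; apply/asboolP.
  by move=> /imfsetP[j /=]; rewrite inE ffunE cellP => /asboolP ? ->.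
rewrite /counting asboolT//; congr (_%:R%:E).
rewrite set_fsetK card_imfset/=; last exact: val_inj.
by rewrite /occupancy cardE; apply: perm_size; apply: uniq_perm; rewrite ?enum_uniq//.
Qed.

Lemma sigma_sub (X : nat -> {RV P >-> R}) E : sigma_of_sequence X E -> measurable E.
Proof.
apply: smallest_sub; first exact: sigma_algebra_measurable.
move=> _ [i _ [B mB <-]]; exact: measurable_funPT.
Qed.

Lemma measurable_cell (o : option 'I_K) : measurable [set x | cell x = o].
Proof.
case: o => [k|].
  rewrite (_ : [set _ | _] = A k)//; apply/seteqP; split=> x /=.
    by move/eqP; rewrite cellP => /asboolP.
  by move=> Akx; apply/eqP; rewrite cellP; apply/asboolP.
rewrite (_ : [set _ | _] = \bigcap_k ~` A k).
  by apply: fin_bigcap_measurable => [|k _]; [exact: finite_finset|exact: measurableC].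
apply/seteqP; split=> x /=.
  move=> xN k _ Akx; have : cell x == Some k by rewrite cellP; apply/asboolP.
  by rewrite xN.
move=> nA; case E : (cell x) => [k|//]; have := nA k I; case.
by apply/asboolP; rewrite -cellP E.
Qed.

(** The pattern of a configuration records which cell holds each of the first
    L points; there are finitely many patterns, and each of them is an event
    about the points only. *)
Definition pattern_event (q : {ffun 'I_L -> option 'I_K}) : set T :=
  [set w | no_late w /\ pattern_of w = q].

Lemma sigma_no_late : sigma_of_sequence tau no_late.
Proof.
rewrite (_ : no_late = \bigcap_(i in [set i | (L <= i)%N]) (tau i @^-1` [set x | cell x = None])).
  by apply: sigma_bigcap => i; apply: sigma_preimage; exact: measurable_cell.
by apply/seteqP; split=> w /=.
Qed.

Lemma sigma_pattern q : sigma_of_sequence tau (pattern_event q).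
Proof.
rewrite (_ : pattern_event q = no_late `&`
    \bigcap_(i in [set: 'I_L]) (tau i @^-1` [set x | cell x = q i])).
  apply: sigma_capI; first exact: sigma_no_late.
  by apply: sigma_bigcap_fin => i; apply: sigma_preimage; exact: measurable_cell.
apply/seteqP; split=> w /= [nl wq]; split=> //.
  by move=> i _ /=; rewrite -wq ffunE.
by apply/ffunP => i; rewrite ffunE; exact: wq.
Qed.

Variable c : 'I_K -> R.
Definition cell_value (o : option 'I_K) : R := if o is Some k then c k else 0.
Variable B : set R.
Hypothesis mB : measurable B.

Definition grid_sum (w : T) : R := \sum_(i < L) beta i w * cell_value (cell (tau i w)).
(** The probability that the marked sum hits B when the points are placed
    according to the list o, [None] standing for a point outside the cells. *)
Definition hit_prob (o : seq (option 'I_K)) : R :=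
  fine (P (lincomb beta (map cell_value o) (iota 0 (size o)) @^-1` B)).

Lemma measurable_lincomb_preimage s J : measurable (lincomb beta s J @^-1` B).
Proof. by rewrite -[X in measurable X]setTI; exact: measurable_lincomb. Qed.

Lemma hit_probE o : P (lincomb beta (map cell_value o) (iota 0 (size o)) @^-1` B) = (hit_prob o)%:E.
Proof.
by rewrite fineK// fin_num_measure//; exact: measurable_lincomb_preimage.
Qed.

Lemma hit_prob_ge0 o : 0 <= hit_prob o.
Proof. exact: fine_ge0. Qed.

(** Once the cells of the points are known the sum is a fixed linear
    combination of marks, and marks are independent of points. *)
Lemma prob_pattern q :
  P (pattern_event q `&` grid_sum @^-1` B) =
  (P (pattern_event q) * (hit_prob (map q (enum 'I_L)))%:E)%E.
Proof.
rewrite -hit_probE size_map size_enum_ord.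
set Y := lincomb beta _ _.
rewrite (_ : _ `&` _ = Y @^-1` B `&` pattern_event q).
  rewrite beta_tau_indep//; first by rewrite muleC.
    exact: sigma_lincomb.
  exact: sigma_pattern.
have E w : pattern_event q w -> grid_sum w = Y w.
  move=> [_ wq]; rewrite /grid_sum /Y /lincomb.
  rewrite -val_enum_ord -map_comp.
  rewrite zip_map big_map big_enum/=; apply: eq_bigr => i _.
  by rewrite mulrC -wq ffunE.
apply/seteqP; split=> w /= [].
  by move=> qw; rewrite E.
by move=> ? qw; rewrite E.
Qed.

(** Only the number of points in each cell matters: points outside the cells
    have coefficient 0, and the marks are exchangeable. *)
Lemma hit_prob_count (o o' : seq (option 'I_K)) :
  (forall k, count_mem (Some k) o = count_mem (Some k) o') ->
  hit_prob o = hit_prob o'.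
Proof.
move=> oo'.
have red o1 : hit_prob o1 = hit_prob (seq.filter isSome o1).
  rewrite /hit_prob; congr fine.
  have p1 : perm_eq o1 (seq.filter isSome o1 ++ nseq (count (predC isSome) o1) None).
    rewrite -(perm_filterC isSome) perm_cat2l.
    elim: o1 => //= -[a|] o1 IH //=.
    by rewrite perm_cons.
  have p2 := perm_map cell_value p1.
  have := lincomb_perm beta_iid p2 mB; rewrite size_map => ->.
  rewrite map_cat map_nseq/= size_cat size_nseq !size_map.
  congr (P _); apply/seteqP.
  have EE := lincomb_pad beta (map cell_value (seq.filter isSome o1)) (count (predC isSome) o1).
  rewrite size_map in EE.
  by split=> w /=; rewrite EE.
rewrite red [RHS]red /hit_prob; congr fine.
have p1 : perm_eq (seq.filter isSome o) (seq.filter isSome o').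
  apply/allP => -[k|] _ /=.
    rewrite !count_filter; apply/eqP; transitivity (count_mem (Some k) o).
      by apply: eq_count => -[?|] //=; rewrite andbT.
    by rewrite oo'; apply: eq_count => -[?|] //=; rewrite andbT.
  rewrite !(count_memPn _)//; by rewrite mem_filter.
have := lincomb_perm beta_iid (perm_map cell_value p1) mB.
by rewrite !size_map.
Qed.

(* Counts are at most L on the event of interest; the bound L + 1 leaves room
   for resetting a count to 1 even when L = 0. *)
Local Notation V := {ffun 'I_K -> 'I_L.+2}.
Definition weight (v : V) : R := \prod_k poisson_pmf r (v k).
Definition cell_list (v : V) : seq (option 'I_K) :=
  flatten [seq nseq (v k) (Some k) | k <- enum 'I_K].

Lemma weight_ge0 v : 0 <= weight v.
Proof. by apply: prodr_ge0 => k _; exact: poisson_pmf_ge0. Qed.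

Lemma count_cell_list v k : count_mem (Some k) (cell_list v) = v k.
Proof.
rewrite /cell_list count_flatten -map_comp sumnE big_map big_enum/=.
rewrite (bigD1 k)//= count_nseq/= eqxx mul1n big1 ?addn0// => j jk.
by rewrite count_nseq/= (_ : Some j == Some k = false)//; apply/negbTE.
Qed.

Let measurable_count k m : measurable [set w | point_count tau (A k) w = m%:R%:E].
Proof.
rewrite -[X in measurable X]setTI.
exact: (measurable_point_count tau (mA k) measurableT (emeasurable_set1 _)).
Qed.

Lemma sum_pmf_le1 (k : 'I_K) m : \sum_(j < m) poisson_pmf r j <= 1.
Proof.
rewrite -lee_fin -sumEFin.
under eq_bigr do rewrite -(prob_count k).
apply: (@le_trans _ _ (P setT)); last by rewrite probability_setT.
apply: prob_pack => // i j w /= -> /eqP; rewrite eqe eqr_nat => /eqP ij.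
exact: val_inj.
Qed.

Lemma sum_weight_le1 : \sum_v weight v <= 1.
Proof.
rewrite /weight -(bigA_distr_bigA (fun (k : 'I_K) (j : 'I_L.+2) => poisson_pmf r j)).
apply: prodr_ile1 => k _; rewrite sum_pmf_le1// andbT sumr_ge0// => j _.
exact: poisson_pmf_ge0.
Qed.

(** All the patterns with counts v make up an event contained in the event that
    the counts are v, whose probability is the product of Poisson masses.  This
    step removes any influence of the enumeration of the points. *)
Lemma sum_pattern_weight (v : V) :
  (\sum_(q : {ffun 'I_L -> option 'I_K} | [forall k, occupancy q k == v k :> nat])
     P (pattern_event q) <= (weight v)%:E)%E.
Proof.
have := @counts_independent K id (fun k => [set (v k)%:R%:E]).
move=> /(_ (@inj_id _) (fun=> emeasurable_set1 _)) => cE.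
apply: (@le_trans _ _ (P (\bigcap_i (point_count tau (A i) @^-1` [set (v i)%:R%:E])))).
  apply: prob_pack.
  - by apply: fin_bigcap_measurable => [|k _]; [exact: finite_finset|exact: measurable_count].
  - by move=> q; apply: sigma_sub; exact: sigma_pattern.
  - move=> q /forallP qv w [nl wq] k _ /=.
    by rewrite count_no_late// wq (eqP (qv k)).
  - by move=> q q' w [_ <-] [_ <-].
rewrite cE /weight -prodEFin le_eqVlt; apply/orP; left; apply/eqP.
by apply: eq_bigr => k _; exact: prob_count.
Qed.

Variables (n : nat) (f : 'I_n -> 'I_K) (Q : R).
Hypothesis finj : injective f.
Hypothesis hit_probQ : forall o, \sum_(j < n) hit_prob (Some (f j) :: o) <= Q.

Lemma measurable_grid_sum : measurable_fun setT grid_sum.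
Proof.
apply: measurable_sum => i; apply: measurable_funM => //.
have -> : (fun w => cell_value (cell (tau i w))) =
    (fun w => \sum_k c k * \1_(A k) (tau i w)).
  apply/funext => w; case E : (cell (tau i w)) => [k1|]/=.
    rewrite (bigD1 k1)//= big1 ?addr0.
      by rewrite indicE mem_set ?mulr1//; apply/asboolP; rewrite -cellP E.
    move=> j jk; rewrite indicE memNset ?mulr0// => /asboolP.
    by rewrite -cellP E => /eqP[] kj; rewrite kj eqxx in jk.
  rewrite big1// => j _; rewrite indicE memNset ?mulr0// => /asboolP.
  by rewrite -cellP E.
apply: measurable_sum => k1; apply: measurable_funM => //.
by apply: measurableT_comp.
Qed.

(** A discrete Mecke formula.  The Poisson masses satisfy
    p(1) = r p(0), so erasing the single point of cell k multiplies the weight by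
    1 / r; the erased point reappears as the head of the list. *)
Lemma prob_single_hit k :
  (P (no_late `&` grid_sum @^-1` B `&` [set w | point_count tau (A k) w = 1%:R%:E]) <=
   (r * \sum_v weight v * hit_prob (Some k :: cell_list v))%:E)%E.
Proof.
have mS : measurable (grid_sum @^-1` B).
  by rewrite -[X in measurable X]setTI; exact: measurable_grid_sum.
have mE q : measurable (pattern_event q) by apply: sigma_sub; exact: sigma_pattern.
have mN : measurable no_late by apply: sigma_sub; exact: sigma_no_late.
apply: (@le_trans _ _ (\sum_(q : {ffun 'I_L -> option 'I_K} | occupancy q k == 1%N)
    P (pattern_event q `&` grid_sum @^-1` B))%E).
  apply: prob_cover => [|q|w [[nl Bw] Nk]].
  - by apply: measurableI => //; apply: measurableI.
  - exact: measurableI.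
  exists (pattern_of w) => //; move: Nk; rewrite /= count_no_late// => /eqP.
  by rewrite eqe eqr_nat.
under eq_bigr do rewrite prob_pattern.
pose cnt (q : {ffun 'I_L -> option 'I_K}) : V := [ffun k => inord (occupancy q k)].
have cntE q k1 : cnt q k1 = occupancy q k1 :> nat.
  rewrite ffunE inordK// ltnS (leq_trans (max_card _))// card_ord; exact: leqnSn.
have hit_prob_cnt (q : {ffun 'I_L -> option 'I_K}) : hit_prob (map q (enum 'I_L)) = hit_prob (cell_list (cnt q)).
  apply: hit_prob_count => k1; rewrite count_cell_list cntE count_map /occupancy.
  rewrite -sum1_count -sum1_card big_enum_cond/=; apply: eq_bigl => i.
  by rewrite inE.
rewrite (partition_big cnt (fun v : V => v k == 1%N :> nat))/=; last first.
  by move=> q qk; rewrite cntE.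
apply: (@le_trans _ _ (\sum_(v : V | v k == 1%N :> nat)
    (weight v * hit_prob (cell_list v))%:E)%E).
  apply: lee_sum => v vk.
  rewrite (eq_bigr (fun q : {ffun 'I_L -> option 'I_K} => P (pattern_event q) * (hit_prob (cell_list v))%:E)%E); last first.
    by move=> q /andP[_ /eqP <-]; rewrite hit_prob_cnt.
  rewrite -ge0_sume_distrl; last by move=> q _.
  rewrite EFinM; apply: lee_wpmul2r; first by rewrite lee_fin hit_prob_ge0.
  apply: le_trans (sum_pattern_weight v).
  rewrite [leLHS](eq_bigl (fun q : {ffun 'I_L -> option 'I_K} => [forall k1, occupancy q k1 == v k1 :> nat]))// => q.
  apply/andP/forallP => [[_ /eqP <-] k1|qv]; first by rewrite cntE.
  split; first by rewrite (eqP (qv k)).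
  by apply/eqP/ffunP => k1; apply: val_inj; rewrite /= cntE (eqP (qv k1)).
rewrite sumEFin lee_fin.
(* clr erases the point of cell k, set1 puts it back. *)
pose clr (v : V) : V := [ffun j => if j == k then ord0 else v j].
pose set1 (v : V) : V := [ffun j => if j == k then inord 1 else v j].
have clrk (v : V) : v k == 1%N :> nat -> weight v * hit_prob (cell_list v) =
    r * (weight (clr v) * hit_prob (Some k :: cell_list (clr v))).
  move=> vk; rewrite mulrA; congr (_ * _).
    rewrite /weight (bigD1 k)//= [in RHS](bigD1 k)//= mulrA; congr (_ * _).
      rewrite ffunE eqxx (eqP vk) /poisson_pmf r0 expr1 expr0 fact0 factS fact0.
      by rewrite muln1 invr1 !mulr1 mul1r.
    by apply: eq_bigr => j jk; rewrite ffunE (negbTE jk).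
  apply: hit_prob_count => j /=; rewrite !count_cell_list ffunE.
  have [->|jk] := eqVneq j k; first by rewrite eqxx (eqP vk).
  by rewrite (_ : Some k == Some j = false)//; apply/negbTE; rewrite eq_sym.
rewrite (eq_bigr _ clrk) -mulr_sumr ler_pM2l//.
rewrite (reindex_onto set1 clr)/=; last first.
  move=> v vk; apply/ffunP => j; rewrite !ffunE; case: eqP => // ->.
  by apply: val_inj; rewrite /= inordK// (eqP vk).
rewrite big_mkcond; apply: ler_sum => v _.
case: ifPn => [/andP[_ /eqP ->]//|_]; rewrite mulr_ge0 ?weight_ge0 ?hit_prob_ge0//.
Qed.

(** Either no cell f j holds exactly one point, which has the probability
    given by independence of the counts, or [prob_single_hit] applies to one of
    them. *)
Lemma prob_grid_sum_hit :
  (P (no_late `&` grid_sum @^-1` B) <=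
    ((1 - poisson_pmf r 1) ^+ n + r * Q)%:E)%E.
Proof.
have mG : measurable (no_late `&` grid_sum @^-1` B).
  apply: measurableI; first by apply: sigma_sub; exact: sigma_no_late.
  by rewrite -[X in measurable X]setTI; exact: measurable_grid_sum.
pose E0 := \bigcap_i (point_count tau (A (f i)) @^-1` ~` [set 1%:R%:E]).
pose Ej j := no_late `&` grid_sum @^-1` B `&` [set w | point_count tau (A (f j)) w = 1%:R%:E].
pose E (i : 'I_n.+1) := if unlift ord0 i is Some j then Ej j else E0.
have m1 : measurable (~` [set 1%:R%:E : \bar R]) by apply: measurableC; exact: emeasurable_set1.
have mE i : measurable (E i).
  rewrite /E; case: (unlift ord0 i) => [j|].
    by apply: measurableI => //; exact: measurable_count.
  apply: fin_bigcap_measurable => [|k _]; first exact: finite_finset.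
  by rewrite -[X in measurable X]setTI; apply: measurable_point_count.
apply: (@le_trans _ _ (\sum_(i < n.+1) P (E i))%E).
  apply: prob_cover => // w Gw.
  have [[j Nj]|nN] := pselect (exists j, point_count tau (A (f j)) w = 1%:R%:E).
    by exists (lift ord0 j) => //; rewrite /E liftK.
  exists ord0 => //; rewrite /E unlift_none => j _ /= Nj; apply: nN; by exists j.
rewrite big_ord_recl EFinD; apply: leeD.
  rewrite /E unlift_none /E0 (counts_independent (B := fun=> ~` [set 1%:R%:E]))//.
  rewrite (eq_bigr (fun=> (1 - poisson_pmf r 1)%:E)); last first.
    move=> j _; rewrite [X in P X](_ : _ = ~` [set w | point_count tau (A (f j)) w = 1%:R%:E])//.
    rewrite probability_setC; last first.
      exact: (measurable_count (f j) 1).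
    by rewrite EFinB -(prob_count (f j)).
  by rewrite prodEFin lee_fin prodr_const card_ord.
under eq_bigr do rewrite /E liftK.
apply: (@le_trans _ _ (\sum_(j < n) (r * \sum_v weight v * hit_prob (Some (f j) :: cell_list v))%:E)%E).
  by apply: lee_sum => j _; exact: prob_single_hit.
rewrite sumEFin lee_fin -mulr_sumr ler_pM2l// exchange_big/=.
under eq_bigr do rewrite -mulr_sumr.
have [Q0|Q0] := leP 0 Q.
  apply: (@le_trans _ _ (\sum_v weight v * Q)).
    by apply: ler_sum => v _; rewrite ler_wpM2l ?weight_ge0.
  by rewrite -mulr_suml ler_piMl// sum_weight_le1.
have := hit_probQ [::]; rewrite leNgt (lt_le_trans Q0)//.
by apply: sumr_ge0 => j _; exact: hit_prob_ge0.
Qed.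
End poisson_cells.

(** * Campbell's formula *)

Lemma nneseries_le_partial {R : realType} (a : nat -> R) (M : R) :
  (forall k, 0 <= a k) -> (forall n, \sum_(k < n) a k <= M) ->
  (\sum_(0 <= k <oo) (a k)%:E <= M%:E)%E.
Proof.
move=> a0 aM; apply: lime_le.
  by apply: is_cvg_nneseries => k _ _; rewrite lee_fin.
by near=> n; rewrite sumEFin big_mkord lee_fin.
Unshelve. all: by end_near. Qed.

Section campbell.
Context {R : realType} {d : measure_display} {T : measurableType d}.
Variable P : probability T R.
Variables beta tau : nat -> {RV P >-> R}.
Variable lambda : R.
Hypothesis lambda0 : 0 < lambda.
Hypothesis beta_iid : iid P beta.
Hypothesis tau_poisson : poisson_field P lambda tau.
Hypothesis beta_tau_indep : independent_sequences P beta tau.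

Lemma sum_poisson_pmf (r : R) : 0 < r ->
  (\sum_(0 <= k <oo) (poisson_pmf r k)%:E = 1)%E.
Proof.
move=> r0; have := @probability_setT _ _ _ (poisson_prob r 0).
rewrite /= /poisson_prob r0 => <-; rewrite nneseries_esumT// => k.
by rewrite lee_fin poisson_pmf_ge0.
Qed.

(** The exact value is r, but any finite bound will do: k <= 2^k compares
    the series with the masses of the Poisson law of parameter 2 r. *)
Lemma sum_poisson_mean (r : R) : 0 < r ->
  (\sum_(0 <= k <oo) (k%:R * poisson_pmf r k)%:E <= (expR r)%:E)%E.
Proof.
move=> r0.
have r20 : 0 < 2 * r by rewrite mulr_gt0.
apply: (@le_trans _ _ (\sum_(0 <= k <oo) (expR r)%:E * (poisson_pmf (2 * r) k)%:E)%E).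
  apply: lee_nneseries => [k _ _|k _].
    by rewrite lee_fin mulr_ge0// poisson_pmf_ge0.
  rewrite -EFinM lee_fin /poisson_pmf r0 r20.
  have -> : expR (- (2 * r)) = expR (- r) * expR (- r).
    by rewrite -expRD; congr expR; ring.
  have er : expR r * expR (- r) = 1 by rewrite -expRD subrr expR0.
  rewrite [leRHS](_ : _ = 2 ^+ k * (r ^+ k / k`!%:R * expR (- r)) * (expR r * expR (- r))); last first.
    by rewrite exprMn; ring.
  rewrite er mulr1 ler_wpM2r//.
    by rewrite mulr_ge0 ?expR_ge0// divr_ge0// exprn_ge0// ltW.
  by rewrite -natrX ler_nat ltnW// ltn_expl.
rewrite nneseriesZl; last by move=> k _; rewrite lee_fin poisson_pmf_ge0.
by rewrite sum_poisson_pmf// mule1.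
Qed.

(** The Poisson masses add up to 1, so the count is almost surely finite and
    its mean is the series of [sum_poisson_mean]. *)
Lemma mean_point_count (A : set R) (h : R) : measurable A -> 0 < h ->
  lebesgue_measure A = h%:E ->
  (\int[P]_w (point_count tau A w) <= (expR (lambda * h))%:E)%E.
Proof.
move=> mA h0 Ah; have r0 : 0 < lambda * h by exact: mulr_gt0.
have mN := measurable_point_count tau mA.
have N0 w : (0 <= point_count tau A w)%E.
  by rewrite point_count_series; apply: nneseries_ge0 => i _ _; rewrite lee_fin.
pose F k := [set w | point_count tau A w = k%:R%:E].
have mF k : measurable (F k).
  by rewrite -[X in measurable X]setTI; exact: (mN measurableT _ (emeasurable_set1 _)).
have PF k : P (F k) = (poisson_pmf (lambda * h) k)%:E.
  have [h1 _] := tau_poisson; rewrite /F h1 ?Ah ?ltry//=.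
  by rewrite /poisson_prob r0 esum_set1// lee_fin poisson_pmf_ge0.
have tF : trivIset setT F.
  move=> i j _ _ [w [/= Ni Nj]]; have /eqP := etrans (esym Ni) Nj.
  by rewrite eqe eqr_nat => /eqP.
have mU : measurable (\bigcup_k F k) by exact: bigcupT_measurable.
have PU : P (\bigcup_k F k) = 1%E.
  rewrite measure_semi_bigcup//= -(sum_poisson_pmf r0).
  by apply: eq_eseriesr => k _; exact: PF.
rewrite (@ge0_negligible_integral _ _ _ P setT (~` \bigcup_k F k))//; last 2 first.
- exact: measurableC.
- by rewrite [LHS]probability_setC// [X in (_ - X)%E]PU subee.
rewrite setTD setCK ge0_integral_bigcup//; last exact: measurable_funTS.
apply: le_trans (sum_poisson_mean r0).
apply: lee_nneseries => [k _ _|k _]; first exact: integral_ge0.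
rewrite (eq_integral (cst k%:R%:E)); last by move=> w; rewrite inE.
by rewrite integral_cst// [X in (_ * X)%E]PF -EFinM.
Qed.

(** The joint law of the i-th mark and the i-th point is a product law. *)
Lemma mean_mark (i : nat) (phi : R -> R) : measurable_fun setT phi ->
  (forall x, 0 <= phi x) ->
  (\int[P]_w (`|beta i w| * phi (tau i w))%:E =
   (\int[P]_w `|beta 0%N w|%:E) * \int[P]_w (phi (tau i w))%:E)%E.
Proof.
move=> mphi phi0.
have mpair : measurable_fun setT (fun w => (beta i w, tau i w)).
  exact/measurable_fun_pair.
have mabs : measurable_fun setT (fun x : R => `|x|%:E) by exact/measurable_EFinP.
have mephi : measurable_fun setT (fun x : R => (phi x)%:E) by exact/measurable_EFinP.
pose f (z : R * R) := (`|z.1| * phi z.2)%:E.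
have f0 z : (0 <= f z)%E by rewrite lee_fin mulr_ge0.
have mf : measurable_fun setT f.
  by apply/measurable_EFinP; apply: measurable_funM; apply: measurableT_comp.
transitivity (\int[pushforward P (fun w => (beta i w, tau i w))]_z f z)%E.
  by rewrite ge0_integral_pushforward//= preimage_setT.
transitivity (\int[distribution P (beta i) \x distribution P (tau i)]_z f z)%E.
  apply: eq_measure_integral => D mD _.
  have := @pair_law _ _ _ P (beta i) (tau i) setT measurableT _ D mD.
  rewrite setTI probability_setT mul1e; apply.
  move=> A B mA mB; rewrite setTI mul1e.
  by apply: beta_tau_indep; exact: sigma_preimage.
rewrite fubini_tonelli1//=.
under eq_integral.
  move=> x _; rewrite /fubini_F/f/=.
  under eq_integral do rewrite EFinM.
  rewrite ge0_integralZl//; last by move=> y _; rewrite lee_fin.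
  over.
rewrite ge0_integralZr//=; last first.
  by apply: integral_ge0 => y _; rewrite lee_fin.
congr (_ * _)%E.
  rewrite (_ : (\int[P]_w _)%E = (\int[distribution P (beta 0%N)]_x `|x|%:E)%E).
    apply: eq_measure_integral => B mB _.
    by case: beta_iid => _ h; exact: h.
  by rewrite /distribution ge0_integral_pushforward//= preimage_setT.
by rewrite /distribution ge0_integral_pushforward//= ?preimage_setT// => y _; rewrite lee_fin.
Qed.

(** This series dominates the shot noise, its discretisation error and its
    interpolation errors alike. *)
Definition total_mark (c : R) (w : T) : \bar R :=
  (\sum_(0 <= i <oo) (`|beta i w| * expR (- c * `|tau i w|))%:E)%E.

Lemma measurable_total_mark c : measurable_fun setT (total_mark c).
Proof.
apply: ge0_emeasurable_sum => [i w _ _|i _]; first by rewrite lee_fin mulr_ge0// expR_ge0.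
apply/measurable_EFinP; apply: measurable_funM; first by apply: measurableT_comp.
apply: measurableT_comp => //; apply: measurable_funM => //; exact: measurableT_comp.
Qed.

Lemma total_mark_ge0 c w : (0 <= total_mark c w)%E.
Proof. by apply: nneseries_ge0 => i _ _; rewrite lee_fin mulr_ge0// expR_ge0. Qed.

(** Campbell's formula.  The exponential is dominated by a step function that
    is constant on the intervals [k, k + 1[ and ]- k - 1, - k], and each of them
    has the same finite mean count. *)
Lemma mean_total_mark (c : R) : 0 < c -> ('E_P[(fun w => `|beta 0%N w|%R)] < +oo)%E ->
  (\int[P]_w total_mark c w < +oo)%E.
Proof.
move=> c0; rewrite unlock => Ebeta.
have mexp : measurable_fun setT (fun x : R => expR (- c * `|x|)).
  by apply: measurableT_comp => //; apply: measurable_funM.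
have mterm i : measurable_fun setT (fun w => (expR (- c * `|tau i w|))%:E).
  by apply/measurable_EFinP; apply: (measurableT_comp mexp).
rewrite /total_mark integral_nneseries//; last first.
  move=> i; apply/measurable_EFinP; apply: measurable_funM; [exact: measurableT_comp|exact: (measurableT_comp mexp)].
rewrite [ltLHS](_ : _ = (\sum_(0 <= i <oo) (\int[P]_w `|beta 0%N w|%:E) *
    \int[P]_w (expR (- c * `|tau i w|))%:E)%E); last first.
  by apply: eq_eseriesr => i _; apply: (mean_mark i mexp) => x; exact: expR_ge0.
have I0 i : (0 <= \int[P]_w (expR (- c * `|tau i w|))%:E)%E.
  by apply: integral_ge0 => w _; rewrite lee_fin expR_ge0.
have B0 : (0 <= \int[P]_w `|beta 0%N w|%:E)%E.
  by apply: integral_ge0 => w _; rewrite lee_fin.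
have -> : (\int[P]_w `|beta 0%N w|%:E = (fine (\int[P]_w `|beta 0%N w|%:E))%:E)%E.
  by rewrite fineK// ge0_fin_numE.
rewrite nneseriesZl// lte_mul_pinfty ?lee_fin ?fine_ge0//.
rewrite -integral_nneseries//.
pose Ap (k : nat) : set R := `[k%:R, k.+1%:R[%classic.
pose Am (k : nat) : set R := `]- k.+1%:R, - k%:R]%classic.
have mAp k : measurable (Ap k) by exact: measurable_itv.
have mAm k : measurable (Am k) by exact: measurable_itv.
have LAp k : lebesgue_measure (Ap k) = 1%:E.
  rewrite /Ap lebesgue_measure_itv/= lte_fin ltr_nat ltnSn -EFinB.
  by rewrite -natrB// subSnn.
have LAm k : lebesgue_measure (Am k) = 1%:E.
  rewrite /Am lebesgue_measure_itv/= lte_fin ltrN2 ltr_nat ltnSn -EFinD opprK addrC.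
  by rewrite -natrB// subSnn.
have N0 A w : (0 <= point_count tau A w :> \bar R)%E.
  by rewrite point_count_series; apply: nneseries_ge0 => i _ _; rewrite lee_fin.
apply: (@le_lt_trans _ _ (\int[P]_w (\sum_(0 <= k <oo)
    (expR (- c * k%:R))%:E * (point_count tau (Ap k) w + point_count tau (Am k) w)))%E).
  apply: le_lower_integral => w.
    by apply: nneseries_ge0 => i _ _; rewrite lee_fin expR_ge0.
  apply: (@le_trans _ _ (\sum_(0 <= i <oo) \sum_(0 <= k <oo)
      (expR (- c * k%:R) * (\1_(Ap k) (tau i w) + \1_(Am k) (tau i w)))%:E)%E).
    apply: lee_nneseries => [i _ _|i _]; first by rewrite lee_fin expR_ge0.
    pose k := Num.trunc `|tau i w|.
    have /andP[k1 k2] : k%:R <= `|tau i w| < k.+1%:R by apply: truncn_itv.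
    have term0 j : (0 <= (expR (- c * j%:R) * (\1_(Ap j) (tau i w) + \1_(Am j) (tau i w)))%:E)%E.
      by rewrite lee_fin mulr_ge0 ?expR_ge0// addr_ge0.
    apply: le_trans (nneseries_lim_ge k.+1 _); last by move=> j _ _; exact: term0.
    rewrite big_nat_recr//= -[leLHS]add0e leeD//; first by apply: sume_ge0 => j _; exact: term0.
    rewrite lee_fin -[leLHS]mulr1 ler_pM ?expR_ge0//.
      by rewrite ler_expR ler_nM2l// oppr_lt0.
    have [t0|t0] := leP 0 (tau i w).
      rewrite ger0_norm// in k1 k2.
      rewrite [X in X + _]indicE mem_set ?lerDl//= /Ap/=.
      by rewrite in_itv/= k1 k2.
    rewrite ltr0_norm// in k1 k2.
    rewrite [X in _ + X]indicE mem_set ?lerDr//= /Am/=.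
    by rewrite in_itv/= ltrNl k2 lerNr.
  rewrite nneseries_interchange; last first.
    by move=> i k; rewrite lee_fin mulr_ge0 ?expR_ge0// addr_ge0.
  apply: lee_nneseries => [k _ _|k _].
    by apply: nneseries_ge0 => i _ _; rewrite lee_fin mulr_ge0 ?expR_ge0// addr_ge0.
  under eq_eseriesr do rewrite EFinM.
  rewrite nneseriesZl; last by move=> i _; rewrite lee_fin addr_ge0.
  rewrite lee_wpmul2l ?lee_fin ?expR_ge0//.
  under eq_eseriesr do rewrite EFinD.
  by rewrite nneseriesD// => *; rewrite ?point_count_series// lee_fin.
rewrite integral_nneseries//; last 2 first.
- move=> k; apply: emeasurable_funM => //; apply: emeasurable_funD; exact: measurable_point_count.
- by move=> k w _; rewrite mule_ge0 ?adde_ge0// lee_fin expR_ge0.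
apply: (@le_lt_trans _ _ (\sum_(0 <= k <oo) (expR (- c) ^+ k)%:E * (expR lambda + expR lambda)%:E)%E).
  apply: lee_nneseries => [k _ _|k _].
    by apply: integral_ge0 => w _; rewrite mule_ge0 ?adde_ge0// lee_fin expR_ge0.
  rewrite ge0_integralZl//; last 2 first.
  - by apply: emeasurable_funD; exact: measurable_point_count.
  - by move=> w _; exact: adde_ge0.
  rewrite expRM_natr lee_wpmul2l// ?lee_fin ?exprn_ge0 ?expR_ge0//.
  rewrite ge0_integralD//; try exact: measurable_point_count.
  rewrite EFinD leeD//; rewrite -(mulr1 lambda); exact: mean_point_count.
under eq_eseriesr do rewrite -EFinM mulrC.
have ec1 : expR (- c) < 1 by rewrite expR_lt1 oppr_lt0.
apply: (@le_lt_trans _ _ ((expR lambda + expR lambda) / (1 - expR (- c)))%:E); last by rewrite ltry.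
apply: nneseries_le_partial => [k|n].
  by rewrite mulr_ge0 ?addr_ge0 ?exprn_ge0 ?expR_ge0.
rewrite -mulr_sumr ler_wpM2l ?addr_ge0 ?expR_ge0//.
rewrite -[leRHS]div1r ler_pdivlMr ?subr_gt0//.
rewrite mulrC -opprB mulNr -subrX1 opprB lerBlDr lerDl exprn_ge0// expR_ge0.
Qed.

(** The enumeration of the points is arbitrary, but it reaches all those of a
    bounded set after finitely many steps. *)
Lemma late_points (A : set R) (h e : R) : measurable A -> 0 < h ->
  lebesgue_measure A = h%:E -> 0 < e ->
  exists L : nat, (P (\bigcup_i (tau (i + L)%N @^-1` A)) <= e%:E)%E.
Proof.
move=> mA h0 Ah e0.
have mF i : measurable (tau i @^-1` A).
  by rewrite -[X in measurable X]setTI; exact: measurable_funPT.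
have S : (\sum_(0 <= i <oo) P (tau i @^-1` A) < +oo)%E.
  apply: le_lt_trans (ltry (expR (lambda * h))).
  apply: le_trans (mean_point_count mA h0 Ah).
  rewrite (eq_integral (fun w => (\sum_(0 <= i <oo) (\1_(tau i @^-1` A) w)%:E)%E)); last first.
    by move=> w _; rewrite point_count_series; apply: eq_eseriesr => i _; rewrite !indicE.
  rewrite integral_nneseries//; last by move=> i; exact/measurable_EFinP.
  apply: lee_nneseries => // i _.
  by rewrite integral_indic// setIT.
have /fine_cvgP[fin /cvgrPdist_le/(_ e e0) tl] := nneseries_tail_cvg S (fun k _ => measure_ge0 P _).
near \oo => L; exists L.
apply: (@le_trans _ _ (\sum_(L <= i <oo) P (tau i @^-1` A))%E).
  apply: (@measure_sigma_subadditive_tail _ _ _ _ _ (fun i => tau i @^-1` A)) => //.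
    exact: bigcupT_measurable.
  move=> w [i _ tiA]; exists (i + L)%N => //=.
  by apply/negP; rewrite -leqNgt leq_addl.
have tL : `|0 - fine (\sum_(L <= k <oo) P (tau k @^-1` A))%E| <= e by near: L.
have fL : (\sum_(L <= k <oo) P (tau k @^-1` A))%E \is a fin_num by near: L.
rewrite -(fineK fL) lee_fin (le_trans (ler_norm _))//.
by rewrite -normrN -sub0r.
Unshelve. all: by end_near. Qed.

Lemma total_mark_markov (c y : R) : 0 < y ->
  (P [set w | (y%:E <= total_mark c w)%E] <=
   (y^-1)%:E * \int[P]_w total_mark c w)%E.
Proof.
move=> y0; rewrite lee_pdivlMl//.
have mS : measurable [set w | (y%:E <= total_mark c w)%E].
  rewrite -[X in measurable X]setTI; apply: emeasurable_fun_c_infty => //.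
  exact: measurable_total_mark.
rewrite -[X in (_ * P X)%E]setIT -integral_indic// -ge0_integralZl//=; last 2 first.
- exact/measurable_EFinP.
- by rewrite lee_fin ltW.
apply: le_lower_integral => w; rewrite -EFinM; first by rewrite lee_fin mulr_ge0// ltW.
rewrite indicE; case: (asboolP (y%:E <= total_mark c w)%E) => h.
  by rewrite mem_set// mulr1.
by rewrite memNset// mulr0 total_mark_ge0.
Qed.

Lemma total_mark_partial (c : R) w n : (total_mark c w < +oo)%E ->
  \sum_(i < n) (`|beta i w| * expR (- c * `|tau i w|)) <= fine (total_mark c w).
Proof.
move=> Vw; rewrite -lee_fin fineK; last first.
  by rewrite ge0_fin_numE// total_mark_ge0.
rewrite -sumEFin -(big_mkord xpredT (fun i => (`|beta i w| * expR (- c * `|tau i w|))%:E)).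
by apply: nneseries_lim_ge => i _ _; rewrite lee_fin mulr_ge0// expR_ge0.
Qed.

Lemma marked_series_cvg (c K : R) (f : R -> R) w : (total_mark c w < +oo)%E ->
  (forall x, `|f x| <= K * expR (- c * `|x|)) ->
  cvgn (series (fun i => beta i w * f (tau i w))).
Proof.
move=> Vw fK; apply: normed_cvg.
have K0 : 0 <= K.
  by have := le_trans (normr_ge0 _) (fK 0); rewrite pmulr_lge0// expR_gt0.
apply: nondecreasing_is_cvgn.
  by apply/nondecreasing_seqP => n; rewrite /normed_series_of seriesSr lerDl/=.
exists (K * fine (total_mark c w)) => _ [n _ <-]; rewrite /normed_series_of seriesEord.
apply: (le_trans _ (ler_wpM2l K0 (total_mark_partial n Vw))).
rewrite mulr_sumr; apply: ler_sum => i _; rewrite /= normrM mulrCA.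
by rewrite ler_wpM2l.
Qed.

End campbell.

(** * Decay of the kernel *)

Section kernel_decay.
Context {R : realType}.
Implicit Types (p : {poly R}) (f : R -> R).

(** Induction on the polynomial: multiplication by X costs half of the
    exponential rate. *)
Lemma poly_le_exp p (c : R) : 0 < c ->
  exists2 K : R, 0 <= K & forall t, `|p.[t]| <= K * expR (c * `|t|).
Proof.
elim/poly_ind: p c => [|p a IH] c c0.
  by exists 0 => // t; rewrite horner0 normr0 mul0r.
have c20 : 0 < c / 2 by rewrite divr_gt0.
have [K K0 pK] := IH _ c20.
exists (K * (2 / c) + `|a|); first by rewrite addr_ge0// mulr_ge0// divr_ge0// ltW.
move=> t; rewrite hornerMXaddC mulrDl (le_trans (ler_normD _ _))// lerD//; last first.
  by rewrite ler_peMr// -expR0 ler_expR mulr_ge0// ltW.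
rewrite normrM; have -> : c * `|t| = c / 2 * `|t| + c / 2 * `|t| by field.
rewrite expRD [leRHS](_ : _ = K * expR (c / 2 * `|t|) * (2 / c * expR (c / 2 * `|t|))); last by ring.
apply: ler_pM => //.
rewrite -(ler_pM2l c20) mulrA (_ : c / 2 * (2 / c) = 1); last by field; rewrite gt_eqF.
by rewrite mul1r; have := expR_ge1Dx (c / 2 * `|t|); lra.
Qed.

Lemma poly_ge_pinfty p : p != 0 ->
  exists2 e : R, 0 < e & exists M : R, forall t, M <= t -> e <= `|p.[t]|.
Proof.
elim/poly_ind: p => [|p a IH]; first by rewrite eqxx.
have [->|p0 _] := eqVneq p 0.
  rewrite mul0r add0r polyC_eq0 => a0.
  by exists `|a|; [rewrite normr_gt0|exists 0 => t _; rewrite hornerC].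
have [e e0 [M pe]] := IH p0.
exists e => //; exists (Num.max M (1 + `|a| / e)) => t; rewrite ge_max => /andP[Mt at_].
have t0 : 0 <= t by apply: le_trans at_; rewrite addr_ge0// divr_ge0// ltW.
rewrite hornerMXaddC (le_trans _ (lerB_normD _ _))// lerBrDr normrM (ger0_norm t0).
apply: le_trans (ler_wpM2r t0 (pe _ Mt)).
have -> : e + `|a| = e * (1 + `|a| / e) by rewrite mulrDr mulr1 mulrCA divff ?gt_eqF// mulr1.
by rewrite ler_pM2l.
Qed.

(** In particular f2 cannot vanish, since then the quotient would be 0. *)
Lemma equivalent_bounds (F : set_system R) {FF : Filter F} f1 f2 :
  equivalent_at F f1 f2 ->
  \forall t \near F, [/\ f2 t != 0, `|f1 t| <= 2 * `|f2 t| & `|f2 t| / 2 <= `|f1 t|].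
Proof.
move=> /cvgrPdist_le/(_ (2^-1))/(_ ltac:(by rewrite invr_gt0)).
apply: filterS => t.
have [->|f2t] := eqVneq (f2 t) 0.
  by rewrite invr0 mulr0 subr0 normr1 => h; exfalso; move: h; lra.
move=> h; have {h} : `|f2 t - f1 t| <= `|f2 t| / 2.
  have -> : f2 t - f1 t = (1 - f1 t / f2 t) * f2 t by field.
  by rewrite normrM mulrC ler_wpM2l.
move=> h; split => //.
  have -> : f1 t = f2 t - (f2 t - f1 t) by ring.
  by rewrite (le_trans (ler_normB _ _))//; have := normr_ge0 (f2 t); lra.
have -> : `|f2 t| = `|f1 t + (f2 t - f1 t)| by congr `|_|; ring.
have := ler_normD (f1 t) (f2 t - f1 t); move: h.
have -> : f1 t + (f2 t - f1 t) = f2 t by ring.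
lra.
Qed.

(** With E = K / c * exp (- c x), the functions f + E and f - E are monotone on
    the half-line, so f oscillates by at most E y beyond y; small values far away
    fix the limit to be 0. *)
Lemma exp_tail f (K c : R) : 0 < c -> 0 <= K ->
  (forall x : R, derivable f x 1) ->
  (forall x : R, 0 <= x -> `|f^`()%classic x| <= K * expR (- c * x)) ->
  (forall eta y : R, 0 < eta -> exists2 z, y <= z & `|f z| <= eta) ->
  forall y : R, 0 <= y -> `|f y| <= K / c * expR (- c * y).
Proof.
move=> c0 K0 df fK f0 y y0.
have cont (h : R -> R) : (forall x, derivable h x 1) -> forall a b, {within `[a, b], continuous h}.
  move=> dh a b; apply: continuous_subspaceT => x.
  exact/differentiable_continuous/derivable1_diffP.
pose E (x : R) := K / c * expR (- c * x).
have dE (x : R) : is_derive x 1 E (- K * expR (- c * x)).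
  apply: is_derive_eq; rewrite /GRing.scale/=; field.
  by rewrite gt_eqF.
have df' (x : R) := derivableP (df x).
have EE0 (x : R) : 0 <= E x by rewrite mulr_ge0 ?expR_ge0// divr_ge0// ltW.
have step (z : R) : y <= z -> `|f z - f y| <= E y.
  move=> yz.
  have zin : z \in `[y, z] by rewrite in_itv/= yz lexx.
  have yin : y \in `[y, z] by rewrite in_itv/= yz lexx.
  have dfE (x : R) := is_deriveD (df' x) (dE x).
  have dfE' (x : R) := is_deriveB (df' x) (dE x).
  have h1 : f z + E z <= f y + E y.
    apply: (@ler0_derive1_le_cc _ (f + E) y z) => //.
    - move=> x; rewrite in_itv/= => /andP[yx _]; rewrite derive1E (@derive_val _ _ _ _ _ _ _ (dfE x)).
      by have := fK x (le_trans y0 (ltW yx)); rewrite derive1E ler_norml => /andP[_]; lra.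
    - by apply: cont => x; apply: (@ex_derive _ _ _ _ _ _ _ (dfE x)).
  have h2 : f y - E y <= f z - E z.
    apply: (@ger0_derive1_le_cc _ (f - E) y z) => //.
    - move=> x; rewrite in_itv/= => /andP[yx _]; rewrite derive1E (@derive_val _ _ _ _ _ _ _ (dfE' x)).
      by have := fK x (le_trans y0 (ltW yx)); rewrite derive1E ler_norml => /andP[]; lra.
    - by apply: cont => x; apply: (@ex_derive _ _ _ _ _ _ _ (dfE' x)).
  rewrite ler_norml; have := EE0 z; have := EE0 y; lra.
apply/ler_addgt0Pr => eta eta0.
have [z yz fz] := f0 eta y eta0.
have -> : f y = f z - (f z - f y) by ring.
by rewrite (le_trans (ler_normB _ _))// addrC lerD// step.
Qed.

Lemma derivable_within f : (forall x : R, derivable f x 1) ->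
  forall a b, {within `[a, b], continuous f}.
Proof.
move=> df a b; apply: continuous_subspaceT => x.
exact/differentiable_continuous/derivable1_diffP.
Qed.

(** An exponential bound near infinity extends to the line, because f is
    bounded on compact intervals. *)
Lemma exp_bound f (K0 c M : R) : 0 < c ->
  (forall x : R, derivable f x 1) ->
  (forall t, M <= `|t| -> `|f t| <= K0 * expR (- c * `|t|)) ->
  exists2 K : R, 0 <= K & forall t, `|f t| <= K * expR (- c * `|t|).
Proof.
move=> c0 df fM.
have cf : {within `[- `|M|, `|M|], continuous (fun x => `|f x|)}.
  move=> x; apply: (@cvg_comp _ _ _ _ Num.norm); first exact: derivable_within.
  exact: norm_continuous.
have [|m _ fm] := EVT_max _ cf; first by have := normr_ge0 M; lra.
pose B := `|f m| * expR (c * `|M|).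
have B0 : 0 <= B by rewrite mulr_ge0 ?expR_ge0.
exists (`|K0| + B); first by rewrite addr_ge0.
move=> t; rewrite mulrDl.
have [Mt|tM] := leP `|M| `|t|.
  have : `|f t| <= K0 * expR (- c * `|t|) by apply: fM; exact: le_trans (ler_norm _) Mt.
  have : K0 * expR (- c * `|t|) <= `|K0| * expR (- c * `|t|).
    by rewrite ler_wpM2r ?expR_ge0// ler_norm.
  have : 0 <= B * expR (- c * `|t|) by rewrite mulr_ge0 ?expR_ge0.
  lra.
have h1 : `|f t| <= `|f m|.
  by apply: (fm t); rewrite in_itv/= -ler_norml ltW.
have h2 : `|f m| <= B * expR (- c * `|t|).
  rewrite /B -mulrA -expRD ler_peMr// -expR0 ler_expR.
  have : 0 <= c * (`|M| - `|t|) by rewrite mulr_ge0 ?subr_ge0// ltW.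
  lra.
have : 0 <= `|K0| * expR (- c * `|t|) by rewrite mulr_ge0 ?expR_ge0.
lra.
Qed.

Variables (g : R -> R) (alpha : R) (c C : nat -> {poly R}).
Hypothesis alpha0 : 0 < alpha.
Hypothesis g_smooth : smooth g.
Hypothesis g_L1 : lebesgue_measure.-integrable [set: R] (EFin \o g).
Hypothesis g_ninfty : forall k : nat, (1 <= k)%N ->
  equivalent_at -oo (g^`(k))%classic (fun t => (c k).[t] * expR (alpha * t)).
Hypothesis g_pinfty : forall k : nat, (1 <= k)%N ->
  equivalent_at +oo (g^`(k))%classic (fun t => (C k).[t] * expR (- alpha * t)).

Let tail_bound f (p : {poly R}) t : `|f t| <= 2 * `|p.[t] * expR (- alpha * `|t|)| ->
  forall K, (forall t, `|p.[t]| <= K * expR (alpha / 2 * `|t|)) ->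
  `|f t| <= 2 * K * expR (- (alpha / 2) * `|t|).
Proof.
move=> ft K pK; apply: (le_trans ft); rewrite normrM (ger0_norm (expR_ge0 _)).
rewrite -mulrA ler_pM2l//.
have -> : - (alpha / 2) * `|t| = alpha / 2 * `|t| + - alpha * `|t| by field.
by rewrite expRD mulrA ler_wpM2r// expR_ge0.
Qed.

(** Half of the rate alpha pays for the polynomial factors. *)
Lemma deriv_decay k : (1 <= k)%N ->
  exists2 K : R, 0 <= K & forall t, `|g^`(k)%classic t| <= K * expR (- (alpha / 2) * `|t|).
Proof.
move=> k1.
have a20 : 0 < alpha / 2 by rewrite divr_gt0.
have [K1 K10 pK1] := poly_le_exp (c k) a20.
have [K2 K20 pK2] := poly_le_exp (C k) a20.
have [M1 [_ hM1]] := equivalent_bounds (g_ninfty k1).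
have [M2 [_ hM2]] := equivalent_bounds (g_pinfty k1).
have := @exp_bound (g^`(k))%classic (2 * (K1 + K2)) (alpha / 2)
  (`|M1| + `|M2| + 1) a20 (@g_smooth k); apply=> t Mt.
have [t0|t0] := leP 0 t.
  have [|_ h _] := hM2 t.
    rewrite (ger0_norm t0) in Mt; have := ler_norm M2; have := normr_ge0 M1; lra.
  have tt : - alpha * t = - alpha * `|t| by rewrite (ger0_norm t0).
  rewrite tt in h.
  have := tail_bound h pK2.
  have : 0 <= K1 * expR (- (alpha / 2) * `|t|) by rewrite mulr_ge0 ?expR_ge0.
  lra.
have [|_ h _] := hM1 t.
  rewrite (ltr0_norm t0) in Mt; have := ler_norm (- M1); rewrite normrN; have := normr_ge0 M2; lra.
have tt : alpha * t = - alpha * `|t| by rewrite (ltr0_norm t0) mulrNN.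
rewrite tt in h.
have := tail_bound h pK1.
have : 0 <= K2 * expR (- (alpha / 2) * `|t|) by rewrite mulr_ge0 ?expR_ge0.
lra.
Qed.

(** The polynomial C 1 is nonzero because g' is equivalent to its product
    with an exponential; a nonzero polynomial is bounded away from 0 near
    infinity. *)
Lemma deriv_lower : exists2 A : R, 0 < A & exists2 eta : R, 0 < eta &
  forall t, A <= t -> eta * expR (- alpha * t) <= `|g^`()%classic t|.
Proof.
have k1 : (1 <= 1)%N by [].
have [M2 [_ hM2]] := equivalent_bounds (g_pinfty k1).
have C0 : C 1%N != 0.
  apply/eqP => C0; have [|/eqP] := hM2 (M2 + 1); first by rewrite ltrDl.
  by rewrite C0 horner0 mul0r.
have [e e0 [M pe]] := poly_ge_pinfty C0.
exists (`|M| + `|M2| + 1); first by rewrite ltr_wpDl// addr_ge0.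
exists (e / 2); first by rewrite divr_gt0.
move=> t Mt; have [|_ _] := hM2 t.
  by have := ler_norm M2; have := normr_ge0 M; lra.
have := pe t; have : M <= t by have := ler_norm M; have := normr_ge0 M2; lra.
move=> -> /(_ isT) ept; rewrite derive1n1; apply: le_trans.
rewrite normrM (ger0_norm (expR_ge0 _)) mulrAC ler_wpM2r// ?invr_ge0//.
by rewrite ler_wpM2r// expR_ge0.
Qed.

(** An integrable function cannot exceed eta in absolute value on an interval
    whose length exceeds its integral divided by eta. *)
Lemma small_values (eta y : R) : 0 < eta ->
  (exists2 z, y <= z & `|g z| <= eta) /\ (exists2 z, z <= y & `|g z| <= eta).
Proof.
move=> eta0.
have [mg Ig] := integrableP _ _ _ g_L1.
have I0 : (0 <= \int[lebesgue_measure]_x `|(g x)%:E|)%E by exact: integral_ge0.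
pose I := fine (\int[lebesgue_measure]_x `|(g x)%:E|)%E.
have IE : (\int[lebesgue_measure]_x `|(g x)%:E|)%E = I%:E by rewrite fineK// ge0_fin_numE.
have [l l0 Il] : exists2 l, 0 < l & I < eta * l.
  exists ((`|I| + 1) / eta); first by rewrite divr_gt0// ltr_wpDl.
  by rewrite mulrC divfK ?gt_eqF//; have := ler_norm I; lra.
have key a : exists2 z, a <= z <= a + l & `|g z| <= eta.
  apply/not_exists2P => nz.
  have gz z : a <= z <= a + l -> eta < `|g z|.
    by move=> az; rewrite ltNge; apply/negP => gz; have [] := nz z.
  move: Il; apply/negP; rewrite -leNgt -lee_fin -IE.
  apply: (@le_trans _ _ (\int[lebesgue_measure]_(x in `[a, (a + l)%R]%classic) eta%:E)%E).
    rewrite integral_cst//= lebesgue_measure_itv/= lte_fin ltrDl l0.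
    by rewrite -EFinD -EFinM lee_fin addrAC subrr add0r.
  apply: (@le_trans _ _ (\int[lebesgue_measure]_(x in `[a, (a + l)%R]%classic) `|(g x)%:E|)%E).
    apply: ge0_le_integral => //=.
    - by move=> x _; rewrite lee_fin ltW.
    - by apply: measurable_funTS; exact: (measurableT_comp (@abse_measurable R setT) mg).
    - by move=> x; rewrite in_itv/= => ax; rewrite lee_fin ltW// gz.
  apply: ge0_subset_integral => //.
  exact: (measurableT_comp (@abse_measurable R setT) mg).
split.
  by have [z /andP[yz _] gz] := key y; exists z.
by have [z /andP[_ yz] gz] := key (y - l); exists z => //; move: yz; rewrite subrK.
Qed.

(** For k = 0 there is no equivalent to start from: the decay of g' makes g
    converge at both ends, and integrability forces the limits to be 0. *)
Lemma kernel_decay k : exists2 K : R, 0 <= K &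
  forall t, `|g^`(k)%classic t| <= K * expR (- (alpha / 2) * `|t|).
Proof.
case: k => [|k]; last exact: deriv_decay.
have a20 : 0 < alpha / 2 by rewrite divr_gt0.
have [K K0 gK] := deriv_decay (leqnn 1).
rewrite derive1n0; exists (K / (alpha / 2)); first by rewrite divr_ge0// ltW.
have dg x : derivable g x 1 by exact: (@g_smooth 0).
have g1 x : g^`()%classic x = g^`(1)%classic x by rewrite derive1n1.
move=> t; have [t0|t0] := leP 0 t.
  rewrite (ger0_norm t0); apply: (exp_tail a20 K0) => //.
    by move=> x x0; rewrite g1; have := gK x; rewrite (ger0_norm x0).
  by move=> eta y /(small_values y)[].
have dN (x : R) : is_derive x 1 (fun y => g (- y)) (- g^`()%classic (- x)).
  have dgx : is_derive (- x) 1 g ('D_1 g (- x)) := derivableP (dg (- x)).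
  have dopp : is_derive x 1 (fun y : R => - y) (- 1 : R) by exact: (@is_deriveN R R R id x 1 1).
  by apply: (is_derive_eq (is_derive1_comp dgx dopp)); rewrite derive1E mulrN1.
have dN' (x : R) : derivable (fun y => g (- y)) x 1 := @ex_derive _ _ _ _ _ _ _ (dN x).
rewrite (ltr0_norm t0) -{1}(opprK t).
apply: (@exp_tail (fun y => g (- y)) K (alpha / 2) a20 K0 dN').
- move=> x x0; rewrite derive1E derive_val normrN g1.
  by have := gK (- x); rewrite normrN (ger0_norm x0).
- move=> eta y /(small_values (- y))[_ [z zy gz]]; exists (- z); rewrite ?opprK//; lra.
- by rewrite oppr_ge0 ltW.
Qed.

End kernel_decay.

(** * Interpolation errors *)

Section interpolation.
Context {R : realType}.
Implicit Types (f : R -> R) (s : seq R).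

Lemma smooth_derive1 f : smooth f -> smooth f^`()%classic.
Proof. by move=> sf n t; rewrite -derive1Sn; exact: (@sf n.+1). Qed.

(** Rolle's theorem between consecutive zeros.  The bound b is quantified
    inside the conclusion so that the induction keeps the new zeros in the
    interval of the old ones. *)
Lemma rolle_seq f (x0 : R) s : (forall x : R, derivable f x 1) ->
  path <%R x0 s -> all (fun x => f x == 0) (x0 :: s) ->
  exists s', [/\ size s' = size s, path <%R x0 s',
    (forall b, all (fun x => x <= b) (x0 :: s) -> all (fun x => x <= b) s')
    & all (fun x => f^`()%classic x == 0) s'].
Proof.
move=> df; elim: s x0 => [|x1 s IH] x0 /=; first by move=> _ _; exists [::].
move=> /andP[x01 px1] /and3P[/eqP fx0 /eqP fx1 fs].
have [|s' [ss' ps' bs' fs']] := IH x1 px1; first by rewrite /= fx1 eqxx.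
have [|z] := @Rolle _ f x0 x1 x01 (fun x _ => df x) (@derivable_within _ f df x0 x1).
  by rewrite fx0 fx1.
rewrite in_itv/= => /andP[x0z zx1] dz.
exists (z :: s'); split=> /=.
- by rewrite ss'.
- rewrite x0z/=; move: ps'; case: s' {ss' bs' fs'} => //= a s' /andP[x1a ->].
  by rewrite (lt_trans zx1 x1a).
- move=> b /and3P[x0b x1b sb]; rewrite (le_trans (ltW zx1) x1b)/= bs'//=.
  by rewrite x1b.
- by rewrite fs' andbT derive1E derive_val.
Qed.

(** Each application of Rolle's theorem trades one zero for one derivative;
    going back, the mean value theorem from a zero of f multiplies the bound on
    f' by b - a. *)
Lemma bound_of_zeros (m : nat) f s (a b M : R) : smooth f ->
  size s = m -> sorted <%R s -> all (fun x => (a <= x <= b) && (f x == 0)) s ->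
  (forall x, a <= x <= b -> `|f^`(m)%classic x| <= M) ->
  forall t, a <= t <= b -> `|f t| <= M * (b - a) ^+ m.
Proof.
elim: m f s M => [|m IH] f s M sf.
  by move=> _ _ _ fM t tab; rewrite expr0 mulr1; exact: fM.
case: s => [|x0 s]//= [ss] ps /andP[/andP[x0ab /eqP fx0] sab] fM t tab.
have df x : derivable f x 1 by exact: (@sf 0 x).
have [|s' [ss' ps' bs' fs']] := rolle_seq df ps.
  rewrite /= fx0 eqxx/=; apply: sub_all sab => x; by case/andP.
have f'M : forall x, a <= x <= b -> `|f^`()%classic x| <= M * (b - a) ^+ m.
  apply: (IH _ s') => //.
  - exact: smooth_derive1.
  - by rewrite ss'.
  - by move: ps'; exact: path_sorted.
  - have s'b : all (fun x => x <= b) s'.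
      apply: bs'; rewrite /=; case/andP: x0ab => _ -> /=.
      by apply: sub_all sab => x /andP[/andP[]].
    have s'a : all (fun x => x0 < x) s' by exact: order_path_min lt_trans ps'.
    apply/allP => x xs; rewrite (allP fs' _ xs) (allP s'b _ xs) !andbT.
    by case/andP: x0ab => ax0 _; rewrite (le_trans ax0)// ltW// (allP s'a _ xs).
  - by move=> x xab; rewrite -derive1Sn; exact: fM.
have M0 : 0 <= M * (b - a) ^+ m by exact: le_trans (normr_ge0 _) (f'M _ x0ab).
have fxy x y : a <= x -> x < y -> y <= b -> `|f y - f x| <= M * (b - a) ^+ m.+1.
  move=> ax xy yb.
  have dfc (c : R) : is_derive c 1 f (f^`()%classic c) by rewrite derive1E; exact: derivableP.
  have [c] := @MVT _ f f^`()%classic x y xy (fun c _ => dfc c) (@derivable_within _ f df x y).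
  rewrite in_itv/= => /andP[xc cy] ->.
  rewrite normrM exprSr mulrA ler_pM//.
    by apply: f'M; rewrite (le_trans ax (ltW xc)) (le_trans (ltW cy) yb).
  by rewrite gtr0_norm ?subr_gt0//; lra.
case/andP: tab x0ab => a_t tb /andP[ax0 x0b].
case: (ltgtP x0 t) => [x0t|tx0|<-].
- by rewrite -[f t]subr0 -fx0 fxy.
- by rewrite -normrN -[- f t]add0r -fx0 fxy.
- by rewrite fx0 normr0 exprSr mulrA mulr_ge0// subr_ge0 (le_trans a_t tb).
Qed.

Lemma derive1n_horner (p : {poly R}) n : (horner p)^`(n)%classic = horner p^`(n).
Proof.
elim: n => [|n IH]; first by rewrite derive1n0 derivn0.
by rewrite derive1nS IH derivnS -derivE.
Qed.

Lemma derive1nB_horner f (p : {poly R}) n : smooth f ->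
  (fun x => f x - p.[x])^`(n)%classic = (fun x => f^`(n)%classic x - p^`(n).[x]).
Proof.
move=> sf; elim: n => [|n IH]; first by rewrite derive1n0 derivn0.
rewrite derive1nS IH; apply/funext => x.
rewrite derive1E (_ : (fun x => _) = f^`(n)%classic - horner p^`(n))//.
rewrite deriveB; [|exact: sf|exact: derivable_horner].
by rewrite -!derive1E -derive1nS -derivE -derivnS.
Qed.

(** The normalised product of the X - x over the other points x. *)
Lemma lagrange_basis s i : uniq s -> (i < size s)%N ->
  exists2 p : {poly R}, (size p <= size s)%N &
    forall j, (j < size s)%N -> p.[s`_j] = (j == i)%:R.
Proof.
move=> us si.
pose r := seq.filter (predC1 s`_i) s.
pose q := \prod_(x <- r) ('X - x%:P).
have q0 : q.[s`_i] != 0.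
  rewrite horner_prod prodf_seq_neq0; apply/allP => x.
  by rewrite mem_filter/= hornerXsubC subr_eq0 eq_sym => /andP[].
exists (q.[s`_i]^-1 *: q).
  rewrite (leq_trans (size_scale_leq _ _))// size_prod_XsubC size_filter.
  rewrite -(count_predC (pred1 s`_i) s) -[X in (X < _)%N]add0n ltn_add2r.
  by rewrite -has_count has_pred1 mem_nth.
move=> j js; rewrite hornerZ; have [->|ji] := eqVneq j i; first by rewrite mulVf.
rewrite [q.[s`_j]]horner_prod (big_rem s`_j)/=.
  by rewrite hornerXsubC subrr mul0r mulr0.
by rewrite mem_filter/= nth_uniq// ji mem_nth.
Qed.

(** The weights v depend on the points and on t but not on f, which is what
    allows summation over the points of the process. *)
Lemma interpolation_error s (a b t : R) : sorted <%R s ->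
  all (fun x => a <= x <= b) s -> a <= t <= b ->
  exists v : nat -> R, forall f, smooth f ->
    forall M, (forall x, a <= x <= b -> `|f^`(size s)%classic x| <= M) ->
    `|f t - \sum_(i < size s) v i * f s`_i| <= M * (b - a) ^+ size s.
Proof.
move=> ss sab tab.
have us : uniq s by apply: sorted_uniq ss; [exact: lt_trans|exact: ltxx].
have /choice[l ls] : forall i : 'I_(size s), exists p : {poly R}, (size p <= size s)%N /\
    forall j, (j < size s)%N -> p.[s`_j] = (j == i)%:R.
  by move=> i; have [p] := lagrange_basis us (ltn_ord i); exists p.
exists (fun i => if insub i is Some k then (l k).[t] else 0) => f sf M fM.
pose L := \sum_(i < size s) f s`_i *: l i.
have -> : \sum_(i < size s) (if insub (val i) is Some k then (l k).[t] else 0) * f s`_i = L.[t].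
  rewrite horner_sum; apply: eq_bigr => i _.
  by rewrite valK hornerZ mulrC.
have sizeL : (size L <= size s)%N.
  rewrite (leq_trans (size_sum _ _ _))//; apply/bigmax_leqP => i _.
  by rewrite (leq_trans (size_scale_leq _ _))//; case: (ls i).
pose h x := f x - L.[x].
have hn n : h^`(n)%classic = (fun x => f^`(n)%classic x - L^`(n).[x]) by exact: derive1nB_horner.
apply: (@bound_of_zeros (size s) h s a b M) => //.
- move=> n x; rewrite hn; apply: derivableB; first exact: sf.
  exact: derivable_horner.
- apply/allP => x xs; rewrite (allP sab x xs)/= /h subr_eq0.
  have [j js <-] := nthP 0 xs.
  rewrite horner_sum (bigD1 (Ordinal js))//= hornerZ (ls (Ordinal js)).2// eqxx mulr1.
  rewrite big1 ?addr0// => i ij; rewrite hornerZ (ls i).2//.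
  by rewrite eq_sym (_ : (i == j :> nat) = false) ?mulr0//; apply/negbTE.
- by move=> x xab; rewrite hn derivn_poly0// horner0 subr0; exact: fM.
Qed.

End interpolation.

(** * Grids of cells *)

Section cells.
Context {R : realType}.

Definition grid_cell (o h : R) (k : nat) : set R :=
  `[o + k%:R * h, o + k.+1%:R * h[%classic.

Lemma measurable_grid_cell o h k : measurable (grid_cell o h k).
Proof. exact: measurable_itv. Qed.

Lemma grid_cell_measure o h k : 0 < h -> lebesgue_measure (grid_cell o h k) = h%:E.
Proof.
move=> h0; rewrite /grid_cell lebesgue_measure_itv/= lte_fin ltrD2l ltr_pM2r//.
by rewrite ltr_nat ltnSn -EFinB; congr EFin; rewrite -natr1; ring.
Qed.

Lemma grid_cell_trivIset o h K : 0 < h ->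
  trivIset setT (fun k : 'I_K => grid_cell o h k).
Proof.
move=> h0 i j _ _ [x []]; rewrite /grid_cell/= !in_itv/=.
move=> /andP[i1 i2] /andP[j1 j2]; apply: val_inj => /=.
have lt (a b : nat) : o + a%:R * h <= x -> x < o + b.+1%:R * h -> (a <= b)%N.
  move=> ax xb; rewrite -ltnS -(ltr_nat R) -(ltr_pM2r h0).
  by have := le_lt_trans ax xb; rewrite ltrD2l.
by apply/eqP; rewrite eqn_leq !lt.
Qed.

Lemma grid_cell_cover o h K x : 0 < h -> o <= x < o + K%:R * h ->
  exists k : 'I_K, grid_cell o h k x.
Proof.
move=> h0 /andP[ox xK].
have q0 : 0 <= (x - o) / h by rewrite divr_ge0 ?subr_ge0// ltW.
have /andP[] := truncn_itv q0; set k := Num.trunc _ => k1 k2.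
have kK : (k < K)%N.
  rewrite -(ltr_nat R) (le_lt_trans k1)// ltr_pdivrMr//.
  by rewrite ltrBlDl.
exists (Ordinal kK); rewrite /grid_cell/= in_itv/=.
by rewrite -lerBrDl -ler_pdivlMr// k1 -ltrBlDl -ltr_pdivrMr.
Qed.

(** The grid spans [a - n l, a + (n + 1) l[ with step l / n, so that one
    parameter n refines the mesh and enlarges the range at the same time.  Inside,
    the error is the mesh times g'; outside, half of the exponential rate yields
    the factor 1 / n. *)
Lemma grid_approximation (g : R -> R) (K0 K1 c t a l : R) :
  0 < c -> 0 < l -> (forall x : R, derivable g x 1) ->
  (forall x, `|g x| <= K0 * expR (- (2 * c) * `|x|)) ->
  (forall x, `|g^`()%classic x| <= K1 * expR (- (2 * c) * `|x|)) ->
  exists2 D : R, 0 < D & forall n, (0 < n)%N ->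
    (forall k x, grid_cell (a - n%:R * l) (l / n%:R) k x ->
      `|g (t - x) - g (t - (a - n%:R * l + k%:R * (l / n%:R)))| <=
        D / n%:R * expR (- c * `|x|)) /\
    (forall x : R, ~~ (a - n%:R * l <= x < a + (n%:R + 1) * l) ->
      `|g (t - x)| <= D / n%:R * expR (- c * `|x|)).
Proof.
move=> c0 l0 dg gK gK1.
have K00 : 0 <= K0.
  by have := le_trans (normr_ge0 _) (gK 0); rewrite pmulr_lge0// expR_gt0.
have K10 : 0 <= K1.
  by have := le_trans (normr_ge0 _) (gK1 0); rewrite pmulr_lge0// expR_gt0.
pose D1 := l * K1 * expR (2 * c * (`|t| + l)).
pose D2 := K0 * expR (2 * c * `|t|) * (expR (c * `|a|) / (c * l)).
have D10 : 0 <= D1 by rewrite !mulr_ge0 ?expR_ge0// ltW.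
have D20 : 0 <= D2 by rewrite !mulr_ge0 ?expR_ge0// invr_ge0 mulr_ge0// ltW.
exists (D1 + D2 + 1); first by rewrite ltr_wpDl// addr_ge0.
move=> n n0.
have n0R : (0 : R) < n%:R by rewrite ltr0n.
have n1R : (1 : R) <= n%:R by rewrite ler1n.
have e0 x : 0 <= expR (- c * `|x|) by exact: expR_ge0.
split=> [k x|x].
  set h := l / n%:R; set xk := _ + k%:R * h.
  have h0 : 0 < h by rewrite divr_gt0.
  have hl : h <= l by rewrite ler_pdivrMr// ler_peMr// ltW.
  rewrite /grid_cell/= in_itv/= -/xk => /andP[kx xk1].
  have xh : x - xk <= h by move: xk1; rewrite /xk -natr1; lra.
  have bnd : `|g (t - x) - g (t - xk)| <= h * (K1 * expR (2 * c * (`|t| + l)) * expR (- (2 * c) * `|x|)).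
    move: kx; rewrite le_eqVlt => /orP[/eqP <-|kx].
      by rewrite subrr normr0 !mulr_ge0 ?expR_ge0// ltW.
    have dfc (y : R) : is_derive y 1 g (g^`()%classic y) by rewrite derive1E; exact: derivableP.
    have txk : t - x < t - xk by lra.
    have [y] := @MVT _ g g^`()%classic _ _ txk (fun y _ => dfc y) (@derivable_within _ g dg _ _).
    rewrite in_itv/= => /andP[y1 y2] gE.
    rewrite -normrN opprB gE normrM mulrC ler_pM//.
      by rewrite ger0_norm; lra.
    apply: (le_trans (gK1 y)); rewrite -mulrA ler_wpM2l// -expRD ler_expR.
    have xy : `|x| <= `|t| + l + `|y|.
      have -> : x = (t - y) + (x - t + y) by ring.
      rewrite (le_trans (ler_normD _ _))//.
      have : `|x - t + y| <= l by rewrite ger0_norm; lra.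
      have := ler_normB t y; lra.
    have : 0 <= 2 * c * (`|t| + l + `|y| - `|x|).
      by rewrite mulr_ge0 ?subr_ge0// mulr_ge0// ltW.
    lra.
  apply: (le_trans bnd).
  have -> : h * (K1 * expR (2 * c * (`|t| + l)) * expR (- (2 * c) * `|x|)) =
     D1 / n%:R * expR (- (2 * c) * `|x|) by rewrite /D1 /h; field; rewrite gt_eqF.
  rewrite ler_pM ?expR_ge0//.
  - by rewrite divr_ge0// ltW.
  - by rewrite ler_pM2r ?invr_gt0//; lra.
  - by rewrite ler_expR; have := mulr_ge0 (ltW c0) (normr_ge0 x); lra.
move=> out.
have xn : n%:R * l - `|a| <= `|x|.
  move: out; rewrite negb_and -ltNge -leNgt => /orP[h|h].
    by have := ler_norm a; have := ler_norm (- x); rewrite normrN; lra.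
  by have := ler_norm (- a); rewrite normrN; have := ler_norm x; lra.
apply: (le_trans (gK _)).
have h1 : expR (- (2 * c) * `|t - x|) <= expR (2 * c * `|t|) * (expR (- c * `|x|) * expR (- c * `|x|)).
  rewrite -!expRD ler_expR.
  have xt : `|x| <= `|t| + `|t - x|.
    have -> : x = t - (t - x) by ring.
    by rewrite (le_trans (ler_normB _ _))//; have -> : t - (t - (t - x)) = t - x by ring.
  have := mulr_ge0 (ltW c0) (_ : 0 <= `|t| + `|t - x| - `|x|); lra.
have h2 : expR (- c * `|x|) <= expR (c * `|a|) / (c * l) / n%:R.
  apply: (@le_trans _ _ (expR (c * `|a|) * expR (- (c * l * n%:R)))).
    rewrite -expRD ler_expR.
    have := mulr_ge0 (ltW c0) (_ : 0 <= `|x| - (n%:R * l - `|a|)); lra.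
  rewrite -[leRHS]mulrA ler_wpM2l ?expR_ge0// -invfM expRN lef_pV2 ?posrE ?expR_gt0//.
    by have := expR_ge1Dx (c * l * n%:R); lra.
  by rewrite !mulr_gt0.
apply: (le_trans (ler_wpM2l K00 h1)).
have -> : K0 * (expR (2 * c * `|t|) * (expR (- c * `|x|) * expR (- c * `|x|))) =
  (K0 * expR (2 * c * `|t|) * expR (- c * `|x|)) * expR (- c * `|x|) by ring.
rewrite ler_wpM2r//.
apply: (@le_trans _ _ (D2 / n%:R)).
  by rewrite /D2 -[leRHS]mulrA ler_wpM2l// mulr_ge0 ?expR_ge0.
by rewrite ler_pM2r ?invr_gt0//; lra.
Qed.

End cells.

(** * Small balls for the shot noise *)

Lemma lim_close {R : realType} (u : nat -> R) (S B : R) (L : nat) :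
  cvgn u -> (forall n, (L <= n)%N -> `|u n - S| <= B) -> `|limn u - S| <= B.
Proof.
move=> cu uS.
have cuS : (fun n => `|u n - S|) @ \oo --> `|limn u - S|.
  by apply: cvg_norm; apply: cvgB => //; exact: cvg_cst.
rewrite -(cvg_lim _ cuS)//; apply: limr_le; first by apply/cvg_ex; eexists; exact: cuS.
by exists L => // n Ln; exact: uS.
Qed.

Section concentration.
Context {R : realType} {d : measure_display} {T : measurableType d}.
Variable P : probability T R.
Variables beta tau : nat -> {RV P >-> R}.
Variables (lambda alpha : R) (g : R -> R).
Hypothesis lambda0 : 0 < lambda.
Hypothesis beta_iid : iid P beta.
Hypothesis tau_poisson : poisson_field P lambda tau.
Hypothesis beta_tau_indep : independent_sequences P beta tau.
Hypothesis alpha0 : 0 < alpha.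
Hypothesis alpha_lambda : alpha < lambda.
Variable K0 K1 : R.
Let c := alpha / 4.
Hypothesis dg : forall x : R, derivable g x 1.
Hypothesis gK : forall x, `|g x| <= K0 * expR (- (2 * c) * `|x|).
Hypothesis gK1 : forall x, `|g^`()%classic x| <= K1 * expR (- (2 * c) * `|x|).
Variables A0 eta : R.
Hypothesis eta0 : 0 < eta.
Hypothesis g_lower : forall t, A0 <= t -> eta * expR (- alpha * t) <= `|g^`()%classic t|.
Variable Kb : R.
Hypothesis Kb0 : 0 <= Kb.
Hypothesis beta_small : forall rho : R, 0 < rho ->
  (P [set w | (`|beta 0%N w| <= rho)%R] <= (Kb * rho)%:E)%E.
Hypothesis total_mark_fin : (\int[P]_w total_mark beta tau c w < +oo)%E.

Let c0 : 0 < c. Proof. by rewrite divr_gt0. Qed.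

Section grid.
Variables (n L : nat) (t l : R).
Hypothesis n0 : (0 < n)%N.
Hypothesis l0 : 0 < l.

Let r := A0 + l.
Let h := l / n%:R.
Let o := t - r - n%:R * l.
Let K := ((2 * n + 1) * n)%N.
Let cells (k : 'I_K) := grid_cell o h k.
Let coef (k : 'I_K) := g (t - (o + k%:R * h)).

Let nR0 : (0 : R) < n%:R. Proof. by rewrite ltr0n. Qed.
Let h0 : 0 < h. Proof. by rewrite divr_gt0. Qed.

(* The window [t - r, t - A0[ consists of the n cells of index n * n + j. *)
Let window_proof (j : 'I_n) : (n * n + j < K)%N.
Proof. by rewrite /K mulnDl mul1n -mulnA mul2n -addnn -addnA ltn_add2l (leq_trans (ltn_ord j))// leq_addl. Qed.
Let window (j : 'I_n) : 'I_K := Ordinal (window_proof j).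

Let coef_window j : coef (window j) = g (r - j%:R * h).
Proof.
rewrite /coef /o /=; congr g; rewrite natrD natrM /h; field.
by rewrite gt_eqF.
Qed.

Let jh (j : 'I_n) : j%:R * h < l.
Proof. by rewrite /h mulrCA gtr_pMr// ltr_pdivrMr// mul1r ltr_nat. Qed.

(** On [A0, r] the derivative of g is at least eta * exp (- alpha r) in absolute
    value, and the mean value theorem turns this into separation of the values at
    the grid points. *)
Lemma window_separated (i j : 'I_n) : (i <= j)%N ->
  eta * expR (- alpha * r) * h * (j%:R - i%:R) <= `|coef (window j) - coef (window i)|.
Proof.
rewrite !coef_window leq_eqVlt => /orP[/eqP ->|ij].
  by rewrite !subrr mulr0 normr0.
have xy : r - j%:R * h < r - i%:R * h by rewrite ltrD2l ltrN2 ltr_pM2r// ltr_nat.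
have dfc (y : R) : is_derive y 1 g (g^`()%classic y) by rewrite derive1E; exact: derivableP.
have [y] := @MVT _ g g^`()%classic _ _ xy (fun y _ => dfc y) (@derivable_within _ g dg _ _).
rewrite in_itv/= => /andP[y1 y2] gE.
rewrite -normrN opprB gE normrM.
have -> : r - i%:R * h - (r - j%:R * h) = h * (j%:R - i%:R) by ring.
rewrite -mulrA ler_pM//.
- by rewrite mulr_ge0 ?expR_ge0// ltW.
- by rewrite mulr_ge0 ?subr_ge0 ?ler_nat ?(ltnW ij)// ltW.
- have yA : A0 <= y by have := jh j; rewrite /r in y1 *; lra.
  apply: le_trans (g_lower yA); rewrite ler_pM2l// ler_expR.
  have yr : y <= r.
    by rewrite (le_trans (ltW y2))// lerBlDr lerDl mulr_ge0// ltW.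
  have := mulr_ge0 (ltW alpha0) (_ : 0 <= r - y); rewrite subr_ge0 => /(_ yr); lra.
- by rewrite ger0_norm// mulr_ge0 ?subr_ge0 ?ler_nat ?(ltnW ij)// ltW.
Qed.

Lemma prob_grid_sum (u e rho : R) : 0 <= e -> 0 < rho ->
  (P (no_late tau cells L `&` grid_sum beta tau cells L coef @^-1` [set x | (`|x - u| <= e)%R]) <=
   ((1 - poisson_pmf (lambda * h) 1) ^+ n +
    (lambda * l * (Kb * rho) + lambda * h +
     lambda * (2 * e / (rho * (eta * expR (- alpha * r))))))%:E)%E.
Proof.
move=> e0 rho0.
have er0 : 0 < eta * expR (- alpha * r) by rewrite mulr_gt0 ?expR_gt0.
have mball : measurable [set x : R | `|x - u| <= e].
  rewrite (_ : [set _ | _] = `[u - e, u + e]%classic).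
    exact: measurable_itv.
  by apply/seteqP; split=> x /=; rewrite in_itv/= ler_distl.
pose Q := n%:R * (Kb * rho) + (1 + 2 * e / (rho * (eta * expR (- alpha * r) * h))).
apply: (@le_trans _ _ ((1 - poisson_pmf (lambda * h) 1) ^+ n + lambda * h * Q)%:E).
  apply: (@prob_grid_sum_hit _ _ _ P beta tau lambda lambda0 beta_iid tau_poisson
    beta_tau_indep K cells h _ _ h0 _ L coef _ mball n window Q).
  - by move=> k; exact: measurable_grid_cell.
  - exact: grid_cell_trivIset.
  - by move=> k; exact: grid_cell_measure.
  - by move=> i j /(congr1 val)/= /addnI ij; exact: val_inj.
  move=> oo; rewrite -lee_fin -sumEFin.
  under eq_bigr do rewrite -hit_probE//.
  have := @sum_small_ball _ _ _ P beta (map (cell_value coef) oo) n (fun j => coef (window j))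
    (eta * expR (- alpha * r) * h) e u rho (mulr_gt0 er0 h0) rho0 e0 window_separated.
  rewrite size_map => H; apply: (le_trans H).
  rewrite /Q [leRHS]EFinD leeD2r// EFinM lee_pmul2l// ?lte_fin//; exact: beta_small.
rewrite lee_fin lerD2l le_eqVlt; apply/orP; left; apply/eqP.
rewrite /Q /h; field; rewrite !gt_eqF// expR_gt0//.
Qed.

End grid.

Lemma shot_noise_cvg t w : (total_mark beta tau c w < +oo)%E ->
  cvgn (series (fun i => beta i w * g (t - tau i w))).
Proof.
move=> Vw; apply: (@marked_series_cvg _ _ _ _ _ _ c (K0 * expR (2 * c * `|t|)) (fun x => g (t - x)) w Vw).
move=> x; apply: (le_trans (gK _)).
have K00 : 0 <= K0.
  by have := le_trans (normr_ge0 _) (gK 0); rewrite pmulr_lge0// expR_gt0.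
rewrite -mulrA ler_wpM2l// -expRD ler_expR.
have xt : `|x| <= `|t| + `|t - x|.
  have -> : x = t - (t - x) by ring.
  by rewrite (le_trans (ler_normB _ _))//; have -> : t - (t - (t - x)) = t - x by ring.
have := mulr_ge0 (ltW c0) (_ : 0 <= `|t| + `|t - x| - `|x|).
have := mulr_ge0 (ltW c0) (normr_ge0 x).
have := mulr_ge0 (ltW c0) (normr_ge0 (t - x)).
rewrite subr_ge0 => h1 h2 /(_ xt); lra.
Qed.

Lemma shot_noise_step (t kappa : R) (K L : nat) (A : 'I_K -> set R) (a : 'I_K -> R) w :
  (total_mark beta tau c w < +oo)%E -> no_late tau A L w ->
  (forall x, `|g (t - x) - cell_value a (cell A x)| <= kappa * expR (- c * `|x|)) ->
  `|shot_noise beta tau g t w - grid_sum beta tau A L a w| <=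
    kappa * fine (total_mark beta tau c w).
Proof.
move=> Vw nl ga; apply: (lim_close (L := L)); first exact: shot_noise_cvg.
have k0 : 0 <= kappa.
  by have := le_trans (normr_ge0 _) (ga 0); rewrite pmulr_lge0// expR_gt0.
move=> N LN; rewrite seriesEord /grid_sum.
rewrite (big_ord_widen _ (fun i => beta i w * cell_value a (cell A (tau i w))) LN).
rewrite big_mkcond -sumrB.
apply: (le_trans _ (ler_wpM2l k0 (total_mark_partial N Vw))).
rewrite mulr_sumr (le_trans (ler_norm_sum _ _ _))//; apply: ler_sum => i _.
rewrite mulrCA; have -> : (if (i < L)%N then beta i w * cell_value a (cell A (tau i w)) else 0) =
    beta i w * cell_value a (cell A (tau i w)).
  by case: ltnP => // Li; rewrite (nl i Li) mulr0.
by rewrite -mulrBr normrM ler_wpM2l.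
Qed.

(** The scales are tied to s as follows: the ball has radius s^8, marks below
    s^2 are discarded, and the length l of the window makes
    exp (- alpha l) proportional to s^2.  The main term is then of order
    s^8 / (s^2 * s^2) = s^4, and discarding small marks costs l * s^2, which is
    O(s).  The series defining X t is only known to
    converge where V is finite, hence the auxiliary event H. *)
Lemma concentration (u : R) : exists2 C : R, 0 <= C &
  forall s t : R, 0 < s <= 1 -> exists H : set T, [/\ measurable H,
    (P H <= (C * s)%:E)%E &
    forall w, (total_mark beta tau c w < +oo)%E ->
      `|shot_noise beta tau g t w - u| <= s ^+ 8 -> H w].
Proof.
pose EV := fine (\int[P]_w total_mark beta tau c w).
have EV0 : 0 <= EV by apply/fine_ge0/integral_ge0 => w _; exact: total_mark_ge0.
have EVE : (\int[P]_w total_mark beta tau c w = EV%:E)%E.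
  by rewrite fineK// ge0_fin_numE//; apply: integral_ge0 => w _; exact: total_mark_ge0.
pose eta' := eta * expR (- alpha * (A0 + 1)).
have eta'0 : 0 < eta' by rewrite mulr_gt0 ?expR_gt0.
pose C := 1 + 1 + (expR 1 + lambda * Kb * (1 + 2 / alpha) + 1 + 4 * lambda / eta').
exists C.
  rewrite !addr_ge0 ?expR_ge0// ?mulr_ge0 ?addr_ge0 ?invr_ge0 ?divr_ge0// ?ltW//.
move=> s t /andP[s0 s1].
pose l := 1 + 2 / alpha * ln s^-1.
have ls0 : 0 <= ln s^-1 by rewrite ln_ge0// invf_ge1.
have l1 : 1 <= l by rewrite /l lerDl mulr_ge0// divr_ge0// ltW.
have l0 : 0 < l by exact: lt_le_trans l1.
have el : expR (- alpha * l) = expR (- alpha) * s ^+ 2.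
  have -> : - alpha * l = - alpha + (ln s *+ 2).
    by rewrite /l lnV ?posrE//; field; rewrite gt_eqF.
  by rewrite expRD -[ln s *+ 2]mulr_natl expRM_natl lnK ?posrE.
have [D D0 gridD] := @grid_approximation _ g K0 K1 c t (t - (A0 + l)) l c0 l0 dg gK gK1.
(* The three summands make the mean discretisation error at most s^9, lambda h at
   most s, and the correction lambda l * lambda h at most 1. *)
pose n := (Num.trunc (D * EV / (s ^+ 8 * s) + lambda * l / s + (lambda * l) ^+ 2)).+1.
have nbig : D * EV / (s ^+ 8 * s) + lambda * l / s + (lambda * l) ^+ 2 <= n%:R.
  exact/ltW/truncnS_gt.
have n0 : (0 < n)%N by [].
have nR0 : (0 : R) < n%:R by rewrite ltr0n.
have [gin gout] := gridD n n0.
set o := t - (A0 + l) - n%:R * l in gin gout.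
set h := l / n%:R in gin.
have h0 : 0 < h by rewrite divr_gt0.
pose K := ((2 * n + 1) * n)%N.
pose cells (k : 'I_K) := grid_cell o h k.
pose coef (k : 'I_K) := g (t - (o + k%:R * h)).
pose range_ : set R := `[o, o + K%:R * h[%classic.
have KhE : K%:R * h = (2 * n%:R + 1) * l.
  by rewrite /K natrM natrD natrM /h; field; rewrite gt_eqF.
have Kh0 : 0 < K%:R * h.
  by rewrite KhE mulr_gt0// ltr_wpDl// mulr_ge0.
have [L late] : exists L : nat, (P (\bigcup_i (tau (i + L)%N @^-1` range_)) <= s%:E)%E.
  apply: (late_points lambda0 tau_poisson (h := K%:R * h)) => //; first exact: measurable_itv.
  by rewrite /range_ lebesgue_measure_itv/= lte_fin ltrDl Kh0 -EFinB addrAC subrr add0r.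
(* Outside H1 the discretisation error is below s^8; outside H2 the first L
   points are all those of the range; H3 is a hit of the discretised sum. *)
pose H1 := [set w | ((s ^+ 8 * n%:R / D)%:E <= total_mark beta tau c w)%E].
pose H2 := \bigcup_i (tau (i + L)%N @^-1` range_).
pose H3 := no_late tau cells L `&` grid_sum beta tau cells L coef @^-1` [set x | (`|x - u| <= 2 * s ^+ 8)%R].
have mrange : measurable range_ by exact: measurable_itv.
have mH1 : measurable H1.
  rewrite -[X in measurable X]setTI; apply: emeasurable_fun_c_infty => //.
  exact: measurable_total_mark.
have mH2 : measurable H2.
  apply: bigcupT_measurable => i; rewrite -[X in measurable X]setTI.
  exact: measurable_funPT.
have mcells k : measurable (cells k) by exact: measurable_grid_cell.
have tcells : trivIset setT cells by exact: grid_cell_trivIset.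
have mH3 : measurable H3.
  apply: measurableI; first by apply: sigma_sub; exact: sigma_no_late.
  rewrite -[X in measurable X]setTI.
  apply: (measurable_grid_sum _ _ mcells tcells L coef) => //.
  rewrite (_ : [set _ | _] = `[u - 2 * s ^+ 8, u + 2 * s ^+ 8]%classic).
    exact: measurable_itv.
  by apply/seteqP; split=> x /=; rewrite in_itv/= ler_distl.
have s80 : 0 < s ^+ 8 by rewrite exprn_gt0.
have s2s : s ^+ 2 <= s by rewrite expr2 ler_piMl// ltW.
have t1 : 0 <= D * EV / (s ^+ 8 * s) by rewrite divr_ge0 ?mulr_ge0// ltW// ?mulr_gt0.
have t2 : 0 <= lambda * l / s by rewrite divr_ge0 ?mulr_ge0// ltW.
have t3 : 0 <= (lambda * l) ^+ 2 by exact: sqr_ge0.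
exists (H1 `|` H2 `|` H3); split.
- by apply: measurableU => //; exact: measurableU.
- have PH1 : (P H1 <= s%:E)%E.
    have y0 : 0 < s ^+ 8 * n%:R / D by rewrite divr_gt0// mulr_gt0.
    apply: (le_trans (@total_mark_markov _ _ _ P beta tau c _ y0)).
    rewrite EVE -EFinM lee_fin mulrC ler_pdivrMr// mulrA ler_pdivlMr//.
    have : D * EV / (s ^+ 8 * s) <= n%:R by lra.
    by rewrite ler_pdivrMr ?mulr_gt0//; lra.
  have PH3 : (P H3 <= ((expR 1 + lambda * Kb * (1 + 2 / alpha) + 1 + 4 * lambda / eta') * s)%:E)%E.
    have e80 : 0 <= 2 * s ^+ 8 by rewrite mulr_ge0// ltW.
    have s20 : 0 < s ^+ 2 by rewrite exprn_gt0.
    apply: (le_trans (prob_grid_sum L t n0 l0 u e80 s20)).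
    rewrite lee_fin.
    rewrite [leRHS](_ : _ = expR 1 * s + (lambda * Kb * (1 + 2 / alpha) * s +
      (s + 4 * lambda / eta' * s))); last by ring.
    have lh0 : 0 < lambda * h by rewrite mulr_gt0.
    have lhn : lambda * h * n%:R = lambda * l by rewrite /h; field; rewrite gt_eqF.
    have pmfE : poisson_pmf (lambda * h) 1 = lambda * h * expR (- (lambda * h)).
      by rewrite /poisson_pmf lh0 expr1 factS fact0 muln1 invr1 mulr1.
    have p1 : 0 <= 1 - poisson_pmf (lambda * h) 1.
      rewrite subr_ge0 pmfE expRN ler_pdivrMr ?expR_gt0// mul1r.
      by have := expR_ge1Dx (lambda * h); lra.
    apply: lerD.
      apply: (@le_trans _ _ (expR (- poisson_pmf (lambda * h) 1) ^+ n)).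
        apply: lerXn2r; rewrite ?nnegrE ?expR_ge0//.
        by have := expR_ge1Dx (- poisson_pmf (lambda * h) 1); lra.
      rewrite -expRM_natr.
      apply: (@le_trans _ _ (expR (1 - alpha * l))).
        rewrite ler_expR pmfE.
        have -> : - (lambda * h * expR (- (lambda * h))) * n%:R = - (lambda * l * expR (- (lambda * h))).
          by rewrite -lhn; ring.
        have e1 : 1 - lambda * h <= expR (- (lambda * h)).
          by have := expR_ge1Dx (- (lambda * h)); lra.
        have ll0 : 0 <= lambda * l by rewrite mulr_ge0// ltW.
        have := ler_wpM2l ll0 e1.
        have : alpha * l <= lambda * l by rewrite ler_pM2r// ltW.
        have : lambda * l * (lambda * h) <= 1.
          have -> : lambda * l * (lambda * h) = (lambda * l) ^+ 2 / n%:R by rewrite /h; field; rewrite gt_eqF.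
          by rewrite ler_pdivrMr// mul1r; lra.
        lra.
      rewrite -mulNr expRD el ler_pM2l ?expR_gt0//.
      have ea : expR (- alpha) <= 1 by rewrite -expR0 ler_expR oppr_le0 ltW.
      by apply: le_trans s2s; apply: ler_piMl => //; exact: ltW.
    rewrite -[leLHS]addrA; apply: lerD.
      have lns : ln s^-1 * s <= 1.
        by rewrite -ler_pdivlMr// mul1r ltW// ln_sublinear// invr_gt0.
      have ls : l * s <= 1 + 2 / alpha.
        rewrite /l mulrDl mul1r lerD// -mulrA.
        by rewrite ler_piMr// divr_ge0// ltW.
      have -> : lambda * l * (Kb * s ^+ 2) = lambda * Kb * (l * s) * s by ring.
      by rewrite ler_pM2r// ler_wpM2l// mulr_ge0// ltW.
    apply: lerD.
      have -> : lambda * h = lambda * l / s / n%:R * s.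
        by rewrite /h; field; rewrite !gt_eqF.
      by apply: ler_piMl; [exact: ltW|rewrite ler_pdivrMr// mul1r; lra].
    have -> : lambda * (2 * (2 * s ^+ 8) / (s ^+ 2 * (eta * expR (- alpha * (A0 + l))))) =
      4 * lambda / eta' * s ^+ 4.
      rewrite mulrDr expRD el /eta' mulrDr mulr1 expRD; field.
      by rewrite !gt_eqF ?expR_gt0.
    apply: ler_wpM2l; first by rewrite divr_ge0 ?mulr_ge0// ltW.
    by rewrite -[leRHS]expr1 ler_wiXn2l// ltW.
  rewrite /C mulrDl mulrDl mul1r !EFinD.
  apply: (le_trans (measureU2 _ _ _)) => //; first exact: measurableU.
  rewrite leeD//; apply: (le_trans (measureU2 _ _ _)) => //.
  by rewrite leeD.
move=> w Vw Xu.
have [?|nH1] := pselect (H1 w); first by left; left.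
have [?|nH2] := pselect (H2 w); first by left; right.
right.
have V0 := total_mark_ge0 beta tau c w.
have cellsR x k : cells k x -> range_ x.
  rewrite /cells /grid_cell /range_/= !in_itv/= => /andP[x1 x2].
  rewrite (le_trans _ x1)/=; last by rewrite lerDl mulr_ge0// ltW.
  by rewrite (lt_le_trans x2)// lerD2l ler_pM2r// ler_nat.
have nl : no_late tau cells L w.
  move=> i Li; case E : (cell cells (tau i w)) => [k|//]; exfalso; apply: nH2.
  exists (i - L)%N => //=; rewrite subnK//; apply: (cellsR _ k).
  by apply/asboolP; rewrite -(cellP tcells) E.
split => //=.
have := @shot_noise_step t (D / n%:R) K L cells coef w Vw nl.
have approx x : `|g (t - x) - cell_value coef (cell cells x)| <= D / n%:R * expR (- c * `|x|).
  case E : (cell cells x) => [k|] /=.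
    by apply: gin; apply/asboolP; rewrite -(cellP tcells) E.
  rewrite subr0; apply: gout; apply/negP => xr.
  have [|k xk] := @grid_cell_cover _ o h K x h0.
    by rewrite KhE (_ : o + _ = t - (A0 + l) + (n%:R + 1) * l)// /o; ring.
  have : cell cells x == Some k by rewrite (cellP tcells); apply/asboolP.
  by rewrite E.
move=> /(_ approx) h1.
have Vs : fine (total_mark beta tau c w) < s ^+ 8 * n%:R / D.
  rewrite -lte_fin fineK ?ge0_fin_numE// ltNge; exact/negP.
have h2 : D / n%:R * fine (total_mark beta tau c w) <= s ^+ 8.
  have -> : s ^+ 8 = D / n%:R * (s ^+ 8 * n%:R / D) by field; rewrite !gt_eqF.
  by rewrite ler_pM2l ?divr_gt0// ltW.
have -> : grid_sum beta tau cells L coef w - u =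
  (shot_noise beta tau g t w - u) - (shot_noise beta tau g t w - grid_sum beta tau cells L coef w) by ring.
rewrite (le_trans (ler_normB _ _))//; lra.
Qed.
End concentration.

(** * Crossings in a short interval *)

Section crossing_pieces.
Context {R : realType} {d : measure_display} {T : measurableType d}.
Variable P : probability T R.
Variables beta tau : nat -> {RV P >-> R}.
Variables (alpha : R) (g : R -> R).
Hypothesis alpha0 : 0 < alpha.
Hypothesis g_smooth : smooth g.
Let c := alpha / 4.
Let c0 : 0 < c. Proof. by rewrite divr_gt0. Qed.

Lemma derive1n_shift (a : R) n :
  (fun x => g (x - a))^`(n)%classic = (fun x => g^`(n)%classic (x - a)).
Proof.
elim: n => [|n IH]; first by rewrite !derive1n0.
rewrite derive1nS IH; apply/funext => x.
have dgx : is_derive (x - a) 1 g^`(n)%classic ('D_1 g^`(n)%classic (x - a)).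
  exact: derivableP (@g_smooth n (x - a)).
have dsh : is_derive x 1 (fun y : R => y - a) (1 : R).
  by apply: is_derive_eq; rewrite subr0.
rewrite derive1E (@derive_val _ _ _ _ _ _ _ (@is_derive1_comp _ g^`(n)%classic (fun y : R => y - a) x _ _ dgx dsh)) mulr1.
by rewrite -derive1E -derive1nS.
Qed.

Lemma smooth_shift (a : R) : smooth (fun x => g (x - a)).
Proof.
move=> n x; rewrite derive1n_shift.
have dgx : is_derive (x - a) 1 g^`(n)%classic ('D_1 g^`(n)%classic (x - a)).
  exact: derivableP (@g_smooth n (x - a)).
have dsh : is_derive x 1 (fun y : R => y - a) (1 : R).
  by apply: is_derive_eq; rewrite subr0.
exact: (@ex_derive _ _ _ _ _ _ _ (@is_derive1_comp _ g^`(n)%classic (fun y : R => y - a) x _ _ dgx dsh)).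
Qed.

Lemma derive1n_cst (a : R) n : (0 < n)%N -> (cst a : R -> R)^`(n)%classic = cst 0.
Proof.
case: n => // n _; rewrite derive1Sn.
have -> : (cst a : R -> R)^`()%classic = cst 0.
  by apply/funext => x; rewrite derive1E derive_val.
elim: n => [|n IH]; first by rewrite derive1n0.
by rewrite derive1nS IH; apply/funext => x; rewrite derive1E derive_val.
Qed.

Lemma smooth_cst (a : R) : smooth (cst a : R -> R).
Proof.
move=> [|n] x; first by rewrite derive1n0; exact: derivable_cst.
by rewrite derive1n_cst//; exact: derivable_cst.
Qed.

Variables (m : nat) (Km rad u : R) (K0 : R).
Hypothesis m0 : (0 < m)%N.
Hypothesis gm : forall x, `|g^`(m)%classic x| <= Km * expR (- (2 * c) * `|x|).
Hypothesis gK : forall x, `|g x| <= K0 * expR (- (2 * c) * `|x|).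

(** Interpolating constants shows that the weights v add up to 1, so u is
    itself the interpolated value of X at a; the difference is the sum over i of
    beta_i times the interpolation error of g (. - tau_i). *)
Lemma many_crossings (a b : R) (s : seq R) w :
  (total_mark beta tau c w < +oo)%E ->
  - rad <= a -> a <= b -> b <= rad -> sorted <%R s -> size s = m ->
  all (fun x => a <= x <= b) s ->
  (forall x, x \in s -> shot_noise beta tau g x w = u) ->
  `|shot_noise beta tau g a w - u| <=
    Km * expR (2 * c * rad) * (b - a) ^+ m * fine (total_mark beta tau c w).
Proof.
move=> Vw ra ab br ss sm sab su.
have aab : a <= a <= b by rewrite lexx.
have [v] := interpolation_error ss sab aab; rewrite sm => vP.
have v1 : \sum_(i < m) v i = 1.
  have := @vP (cst 1) (@smooth_cst 1) 0; rewrite mul0r derive1n_cst// => h.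
  have {h} : `|1 - \sum_(i < m) v i| <= 0.
    have -> : \sum_(i < m) v i = \sum_(i < m) v i * cst 1 s`_i.
      by apply: eq_bigr => i _; rewrite mulr1.
    by apply: h => x _; rewrite normr0.
  by rewrite normr_le0 subr_eq0 eq_sym => /eqP.
have Km0 : 0 <= Km.
  by have := le_trans (normr_ge0 _) (gm 0); rewrite pmulr_lge0// expR_gt0.
pose B := Km * expR (2 * c * rad) * (b - a) ^+ m.
have B0 : 0 <= B by rewrite !mulr_ge0 ?expR_ge0// exprn_ge0// subr_ge0.
have err y : `|g (a - y) - \sum_(i < m) v i * g (s`_i - y)| <= B * expR (- c * `|y|).
  have := @vP _ (@smooth_shift y) (Km * expR (2 * c * rad) * expR (- c * `|y|)).
  rewrite derive1n_shift => h; apply: le_trans (h _) _; last by rewrite /B mulrAC.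
  move=> x /andP[ax xb]; apply: (le_trans (gm _)).
  rewrite -mulrA ler_wpM2l// -expRD ler_expR.
  have xr : `|x| <= rad by rewrite ler_norml; lra.
  have yx : `|y| <= `|x| + `|x - y|.
    have -> : y = x - (x - y) by ring.
    by rewrite (le_trans (ler_normB _ _))//; have -> : x - (x - (x - y)) = x - y by ring.
  have := mulr_ge0 (ltW c0) (_ : 0 <= `|x| + `|x - y| - `|y|).
  have := mulr_ge0 (ltW c0) (_ : 0 <= rad - `|x|).
  have := mulr_ge0 (ltW c0) (normr_ge0 y).
  have := mulr_ge0 (ltW c0) (normr_ge0 (x - y)).
  rewrite !subr_ge0 => h1 h2 /(_ xr) h3 /(_ yx) h4; lra.
have cX t : cvgn (series (fun i => beta i w * g (t - tau i w))) by exact: (shot_noise_cvg alpha0 gK).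
pose U N := series (fun i => beta i w * g (a - tau i w)) N -
  \sum_(j < m) v j * series (fun i => beta i w * g (s`_j - tau i w)) N.
have cU : U @ \oo --> shot_noise beta tau g a w - u.
  have -> : u = \sum_(j < m) v j * shot_noise beta tau g s`_j w.
    rewrite -[LHS]mul1r -v1 mulr_suml; apply: eq_bigr => j _.
    by rewrite su// mem_nth// sm.
  apply: cvgB; first exact: cX.
  apply: (cvg_big (op := +%R)) => [|j _]; first exact: add_continuous.
  by apply: cvgM; [exact: cvg_cst|exact: cX].
rewrite -(cvg_lim _ cU)// -[X in `|X|]subr0.
apply: (lim_close (L := 0%N)); first by apply/cvg_ex; eexists; exact: cU.
move=> N _; rewrite subr0.
have -> : U N = \sum_(i < N) beta i w * (g (a - tau i w) - \sum_(j < m) v j * g (s`_j - tau i w)).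
  rewrite /U; under [X in _ - X]eq_bigr do rewrite seriesEord mulr_sumr.
  rewrite exchange_big/= seriesEord -sumrB; apply: eq_bigr => i _.
  by rewrite mulrBr mulr_sumr; congr (_ - _); apply: eq_bigr => j _; rewrite mulrCA.
apply: (le_trans _ (ler_wpM2l B0 (total_mark_partial N Vw))).
rewrite mulr_sumr (le_trans (ler_norm_sum _ _ _))//; apply: ler_sum => i _.
by rewrite normrM mulrCA ler_wpM2l.
Qed.

End crossing_pieces.

(** * Counting points *)

Section counting_points.
Context {R : realType}.

(** This form covers finite and infinite sets at once. *)
Lemma counting_ge_seq (Z : set R) (k : nat) : (k%:R%:E <= counting Z :> \bar R)%E ->
  exists s : seq R, [/\ uniq s, size s = k & forall x, x \in s -> Z x].
Proof.
rewrite /counting; case: asboolP => [fZ|iZ _].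
  rewrite lee_fin ler_nat => kZ; exists (take k (fset_set Z)); split.
  - by rewrite take_uniq// fset_uniq.
  - by rewrite size_takel.
  - by move=> x /mem_take; rewrite in_fset_set// inE.
have [B BZ kB] := infinite_set_fset k iZ.
exists (take k B); split.
- by rewrite take_uniq// fset_uniq.
- by rewrite size_takel.
- by move=> x /mem_take xB; exact: BZ.
Qed.

Lemma pigeonhole_seq (s : seq R) (n m : nat) (lab : R -> 'I_n) :
  (0 < n)%N -> (0 < m)%N -> (m * n <= size s)%N ->
  exists j, (m <= size [seq x <- s | lab x == j])%N.
Proof.
move=> n0 m0 ms; apply: contrapT => nE.
have nj j : (size [seq x <- s | lab x == j] < m)%N.
  by rewrite ltnNge; apply/negP => mj; apply: nE; exists j.
have : (size s <= \sum_(j < n) m.-1)%N.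
  have -> : size s = (\sum_(j < n) size [seq x <- s | lab x == j])%N.
    rewrite -sum1_size (partition_big lab xpredT)//=; apply: eq_bigr => j _.
    by rewrite -sum1_size big_filter.
  by apply: leq_sum => j _; have := nj j; case: (m) m0.
rewrite sum_nat_const card_ord; apply/negP; rewrite -ltnNge.
by apply: leq_trans ms; rewrite mulnC ltn_pmul2r// prednK.
Qed.

Lemma sorted_take (s : seq R) m : uniq s -> (m <= size s)%N ->
  exists s', [/\ sorted <%R s', size s' = m & {subset s' <= s}].
Proof.
move=> us ms; exists (take m (sort <=%R s)); split.
- apply: take_sorted; rewrite lt_sorted_uniq_le sort_uniq us/=.
  by apply: sort_sorted; exact: le_total.
- by rewrite size_takel// size_sort.
- by move=> x /mem_take; rewrite mem_sort.
Qed.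

Lemma sum_inv_sqr N : \sum_(n < N) (n.+1%:R ^+ 2)^-1 <= 2 :> R.
Proof.
suff : \sum_(n < N) (n.+1%:R ^+ 2)^-1 <= 2 - 2 / N.+1%:R :> R.
  move=> h; apply: (le_trans h); rewrite lerBlDr lerDl divr_ge0//.
elim: N => [|N IH]; first by rewrite big_ord0 divr1 subrr.
rewrite big_ord_recr/=.
have x1 : (1 : R) <= N.+1%:R by rewrite ler1n.
have key : (N.+1%:R ^+ 2)^-1 <= 2 / N.+1%:R - 2 / N.+2%:R :> R.
  rewrite -subr_ge0 -[N.+2%:R]natr1; set x : R := N.+1%:R in x1 *.
  have -> : 2 / x - 2 / (x + 1) - (x ^+ 2)^-1 = (x - 1) / (x ^+ 2 * (x + 1)).
    by field; apply/andP; split; apply/eqP; lra.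
  by rewrite divr_ge0// ?subr_ge0// mulr_ge0 ?sqr_ge0//; lra.
by apply: (le_trans (lerD IH key)); rewrite addrA subrK.
Qed.

End counting_points.

(** * Moments of the number of crossings *)

Section crossing_moments.
Context {R : realType} {d : measure_display} {T : measurableType d}.
Variable P : probability T R.
Variables beta tau : nat -> {RV P >-> R}.
Variables (alpha : R) (g : R -> R) (u : R).
Hypothesis alpha0 : 0 < alpha.
Hypothesis g_smooth : smooth g.
Let c := alpha / 4.
Hypothesis g_decay : forall k, exists2 K : R, 0 <= K &
  forall t, `|g^`(k)%classic t| <= K * expR (- (2 * c) * `|t|).
Hypothesis total_mark_fin : (\int[P]_w total_mark beta tau c w < +oo)%E.
Variable C0 : R.
Hypothesis C00 : 0 <= C0.
Hypothesis conc : forall s t : R, 0 < s <= 1 -> exists H : set T, [/\ measurable H,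
    (P H <= (C0 * s)%:E)%E &
    forall w, (total_mark beta tau c w < +oo)%E ->
      `|shot_noise beta tau g t w - u| <= s ^+ 8 -> H w].

(** With pieces of length dl, m = 16 q and s = dl^q, many crossings in a piece
    give |X - u| <= Kc * V * s^16, which is at most s^8 unless V >= 1 / (Kc s^8).
    Both exceptional events have probability O(s) for one piece, hence
    O(n dl^q) = O(n^(1 - q)) in total. *)
Lemma crossings_tail (I : set R) (k : nat) : bounded_set I ->
  exists2 C : R, 0 <= C & exists2 m : nat, (0 < m)%N &
    forall n : nat, exists E : set T, [/\ measurable E,
      (P E <= (C / n.+1%:R ^+ k)%:E)%E &
      forall w, ((m * n)%:R%:E <= crossings (shot_noise beta tau g) I u w)%E -> E w].
Proof.
move=> [M [_ bI]].
(* The margin makes I a subset of the half-open interval [- rad, rad[,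
   which the half-open cells cover. *)
pose rad := `|M| + 2.
have rad0 : 0 < rad by rewrite ltr_wpDl.
have Irad x : I x -> - rad <= x < rad.
  move=> Ix; have : `|x| <= `|M| + 1 by apply: bI Ix; rewrite (le_lt_trans (ler_norm _))// ltrDl.
  by rewrite ler_norml /rad => /andP[? ?]; apply/andP; split; lra.
pose q := k.+1; pose m := (16 * q)%N.
have m0 : (0 < m)%N by [].
have [Km Km0 gm] := g_decay m.
have [K0 K00 gK] := g_decay 0; rewrite derive1n0 in gK.
pose Kc := Km * expR (2 * c * rad) + 1.
have Kc0 : 0 < Kc by rewrite ltr_wpDl// mulr_ge0 ?expR_ge0.
pose EV := fine (\int[P]_w total_mark beta tau c w).
have EV0 : 0 <= EV by apply/fine_ge0/integral_ge0 => w _; exact: total_mark_ge0.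
have EVE : (\int[P]_w total_mark beta tau c w = EV%:E)%E.
  by rewrite fineK// ge0_fin_numE//; apply: integral_ge0 => w _; exact: total_mark_ge0.
pose N1 := Num.trunc (2 * rad).
have N1P : 2 * rad < N1.+1%:R by exact: truncnS_gt.
pose CA := (EV * Kc + C0) * (2 * rad) ^+ q * 2 ^+ k.
have CA0 : 0 <= CA.
  by rewrite !mulr_ge0 ?exprn_ge0 ?addr_ge0 ?mulr_ge0// ltW.
exists (N1.+1%:R ^+ k + CA); first by rewrite addr_ge0// exprn_ge0.
exists m => // n.
have nk0 : (0 : R) < n.+1%:R ^+ k by rewrite exprn_gt0// ltr0n.
(* For the finitely many n with dl >= 1 the whole space is taken. *)
have [nN1|N1n] := leqP n N1.
  exists setT; split=> //; rewrite probability_setT lee_fin ler_pdivlMr// mul1r.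
  rewrite (@le_trans _ _ (N1.+1%:R ^+ k))//; last by rewrite lerDl.
  by apply: lerXn2r; rewrite ?nnegrE// ler_nat.
have n0 : (0 < n)%N by exact: leq_ltn_trans N1n.
have nR0 : (0 : R) < n%:R by rewrite ltr0n.
pose dl := 2 * rad / n%:R.
have dl0 : 0 < dl by rewrite divr_gt0// mulr_gt0.
have dl1 : dl <= 1.
  by rewrite ler_pdivrMr// mul1r ltW// (lt_le_trans N1P)// ler_nat.
pose s := dl ^+ q.
have s01 : 0 < s <= 1 by rewrite exprn_gt0//= exprn_ile1// ltW.
have [s0 s1] := andP s01.
have ndl : n%:R * dl = 2 * rad by rewrite /dl; field; rewrite gt_eqF.
pose tt (j : 'I_n) := - rad + j%:R * dl.
have /choice[H HP] := fun j => conc (tt j) s01.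
pose y := (Kc * s ^+ 8)^-1.
have y0 : 0 < y by rewrite invr_gt0 mulr_gt0// exprn_gt0.
pose HV := [set w | (y%:E <= total_mark beta tau c w)%E].
have mHV : measurable HV.
  rewrite -[X in measurable X]setTI; apply: emeasurable_fun_c_infty => //.
  exact: measurable_total_mark.
have mH j : measurable (H j) by have [] := HP j.
have mU : measurable (\bigcup_j H j) by apply: fin_bigcup_measurable => //; exact: finite_finset.
exists (HV `|` \bigcup_j H j); split.
- exact: measurableU.
- apply: (@le_trans _ _ (CA / n.+1%:R ^+ k)%:E); last first.
    by rewrite lee_fin ler_pM2r ?invr_gt0// lerDr exprn_ge0.
  apply: (@le_trans _ _ ((EV * Kc + C0) * (n%:R * s))%:E); last first.
    have n1 : (1 : R) <= n%:R by rewrite ler1n.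
    have n2 : n.+1%:R ^+ k <= 2 ^+ k * n%:R ^+ k :> R.
      rewrite -exprMn; apply: lerXn2r; rewrite ?nnegrE ?mulr_ge0//.
      by rewrite -natr1; lra.
    rewrite lee_fin ler_pdivlMr// /CA -ndl exprMn -/s /q exprS.
    rewrite [leRHS](_ : _ = (EV * Kc + C0) * (n%:R * s) * (2 ^+ k * n%:R ^+ k)); last by ring.
    by rewrite ler_wpM2l// !mulr_ge0 ?addr_ge0 ?mulr_ge0// ltW.
  rewrite mulrDl EFinD (le_trans (measureU2 _ _ _))//; apply: leeD.
    apply: (le_trans (@total_mark_markov _ _ _ P beta tau c _ y0)).
    rewrite EVE -EFinM lee_fin /y invrK mulrC -[leRHS]mulrA.
    have s8 : s ^+ 8 <= s.
      by rewrite exprS; apply: ler_piMr; [exact: ltW|apply: exprn_ile1 => //; exact: ltW].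
    rewrite ler_wpM2l// ler_pM2l// (le_trans s8)// ler_peMl ?ler1n// ltW//.
  apply: (@le_trans _ _ (\sum_(j < n) P (H j))%E).
    by apply: prob_cover => // w [j _ Hj]; exists j.
  apply: (@le_trans _ _ (\sum_(j < n) (C0 * s)%:E)%E).
    by apply: lee_sum => j _; have [] := HP j.
  rewrite sumEFin lee_fin sumr_const card_ord le_eqVlt; apply/orP; left; apply/eqP.
  by rewrite -[_ *+ n]mulr_natl; ring.
move=> w cw.
have [?|nHV] := pselect (HV w); first by left.
right.
have V0 := total_mark_ge0 beta tau c w.
have Vy : (total_mark beta tau c w < y%:E)%E by rewrite ltNge; exact/negP.
have Vw : (total_mark beta tau c w < +oo)%E by exact: lt_trans Vy (ltry _).
have [s0' [us ss sI]] := counting_ge_seq cw.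
pose lab x : 'I_n := odflt (Ordinal n0) [pick j : 'I_n | `[< grid_cell (- rad) dl j x >]].
have labP x : I x -> grid_cell (- rad) dl (lab x) x.
  move=> Ix; rewrite /lab; case: pickP => [j /asboolP//|nj].
  have [|j /asboolP] := @grid_cell_cover _ (- rad) dl n x dl0; last by rewrite nj.
  rewrite ndl (_ : - rad + 2 * rad = rad); [exact: Irad|by ring].
have [|j mj] := @pigeonhole_seq _ s0' n m lab n0 m0; first by rewrite ss.
have [s' [s's s'm s'sub]] := sorted_take (filter_uniq _ us) mj.
exists j => //; have [_ _ HjP] := HP j; apply: (HjP w Vw).
have s'P x : x \in s' -> [/\ I x, shot_noise beta tau g x w = u & lab x = j].
  by move=> /s'sub; rewrite mem_filter => /andP[/eqP -> /sI[]].
apply: (le_trans (@many_crossings _ _ _ P beta tau alpha g alpha0 g_smooth m Km rad u K0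
  m0 gm gK (tt j) (tt j + dl) s' w Vw _ _ _ s's s'm _ _)).
- by rewrite lerDl mulr_ge0// ltW.
- by rewrite lerDl ltW.
- rewrite /tt -addrA -{2}[dl]mul1r -mulrDl natr1.
  have : j.+1%:R * dl <= n%:R * dl by rewrite ler_pM2r// ler_nat.
  by rewrite ndl; lra.
- apply/allP => x /s'P[Ix _ labx]; have := labP x Ix.
  rewrite labx /grid_cell/= in_itv/= /tt => /andP[-> /ltW].
  by rewrite -natr1 mulrDl mul1r addrA.
- by move=> x /s'P[].
rewrite [tt j + dl - tt j]addrAC subrr add0r.
have Vf : fine (total_mark beta tau c w) <= y.
  by rewrite -lee_fin fineK ?ge0_fin_numE// ltW.
have Vf0 : 0 <= fine (total_mark beta tau c w) by exact: fine_ge0.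
have -> : dl ^+ m = s ^+ 16 by rewrite /s -exprM mulnC.
have -> : s ^+ 8 = Kc * s ^+ 16 * y.
  by rewrite /y; field; rewrite !gt_eqF.
apply: ler_pM => //.
  by rewrite !mulr_ge0 ?expR_ge0// exprn_ge0// ltW.
by rewrite ler_pM2r ?exprn_gt0// lerDl.
Qed.

(** The p-th power of N is at most the sum over n of (m (n + 1))^p over the n
    with N >= m n: the term n = N / m suffices when N is finite, and all the
    terms are at least 1 when it is infinite.  With k > p, the tail exponent k + 2
    leaves a convergent series of inverse squares. *)
Lemma crossings_moment (I : set R) (p : R) : bounded_set I -> 1 <= p ->
  (\int[P]_w (crossings (shot_noise beta tau g) I u w `^ p) < +oo)%E.
Proof.
move=> bI p1; pose k := (Num.trunc p).+1.
have pk : p <= k%:R by exact/ltW/truncnS_gt.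
have p0 : 0 <= p by exact: le_trans p1.
have [C C_ge0 [m m0 tailE]] := crossings_tail k.+2 bI.
have [E EP] := choice tailE.
have mE n : measurable (E n) by have [] := EP n.
pose N := crossings (shot_noise beta tau g) I u.
pose a n : R := (m * n.+1)%:R `^ p.
have a0 n : 0 <= a n by exact: powR_ge0.
have a1 n : 1 <= a n.
  rewrite -(powRr0 (m * n.+1)%:R); apply: ler_powR => //.
  by rewrite ler1n muln_gt0 m0.
apply: (@le_lt_trans _ _ (\int[P]_w (\sum_(0 <= n <oo) (a n * \1_(E n) w)%:E))%E).
  apply: le_lower_integral => w; first exact: poweR_ge0.
  have term0 n : (0 <= (a n * \1_(E n) w)%:E)%E by rewrite lee_fin mulr_ge0.
  rewrite -/(N w); have : (forall n, ((m * n)%:R%:E <= N w)%E -> E n w) by move=> n; have [_ _] := EP n; exact.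
  rewrite /N /crossings /counting; case: asboolP => [fZ|iZ] NE.
    set x := #|` _ | in NE *.
    apply: (@le_trans _ _ (a (x %/ m)%N * \1_(E (x %/ m)%N) w)%:E).
      rewrite poweR_EFin lee_fin indicE mem_set ?mulr1; last first.
        by apply: NE; rewrite lee_fin ler_nat mulnC leq_trunc_div.
      rewrite /a ge0_ler_powR// ?nnegrE// ler_nat mulnC.
      by rewrite ltnW// ltn_ceil.
    apply: le_trans (nneseries_lim_ge (x %/ m).+1 (fun n _ _ => term0 n)).
    by rewrite big_nat_recr//= leeDr// sume_ge0.
  rewrite (_ : (\sum_(0 <= n <oo) _ = +oo)%E) ?leey//.
  apply/eqyP => A A0.
  have En n : E n w by apply: NE; rewrite leey.
  apply: le_trans (nneseries_lim_ge (Num.trunc A).+1 (fun n _ _ => term0 n)).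
  rewrite sumEFin lee_fin (@le_trans _ _ (Num.trunc A).+1%:R)//.
    exact/ltW/truncnS_gt.
  rewrite big_mkord -[X in X%:R](card_ord (Num.trunc A).+1) -sum1_card natr_sum.
  by apply: ler_sum => n _; rewrite indicE mem_set// mulr1.
rewrite integral_nneseries//; last 2 first.
- by move=> n; apply/measurable_EFinP; apply: measurable_funM.
- by move=> n w _; rewrite lee_fin mulr_ge0.
apply: (@le_lt_trans _ _ ((m%:R ^+ k * C * 2)%:E)); last by rewrite ltry.
apply: (@le_trans _ _ (\sum_(0 <= n <oo) (m%:R ^+ k * C * (n.+1%:R ^+ 2)^-1)%:E)%E).
  apply: lee_nneseries => [n _ _|n _].
    by apply: integral_ge0 => w _; rewrite lee_fin mulr_ge0.
  under eq_integral do rewrite EFinM.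
  rewrite ge0_integralZl//; [|exact/measurable_EFinP|by rewrite lee_fin].
  rewrite integral_indic// setIT.
  have [_ PE _] := EP n.
  apply: (le_trans (lee_wpmul2l _ PE)); first by rewrite lee_fin.
  rewrite -EFinM lee_fin.
  have x1 : (1 : R) <= (m * n.+1)%:R by rewrite ler1n muln_gt0 m0.
  have ak : a n <= m%:R ^+ k * n.+1%:R ^+ k.
    rewrite /a -exprMn -natrM -powR_mulrn//.
    exact: ler_powR.
  have xn : (0 : R) < n.+1%:R by rewrite ltr0n.
  apply: (le_trans (ler_wpM2r _ ak)); first by rewrite divr_ge0// exprn_ge0.
  rewrite le_eqVlt; apply/orP; left; apply/eqP.
  rewrite -addn2 exprD; set x : R := n.+1%:R in xn *.
  have x0 : x != 0 by rewrite gt_eqF.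
  by field; rewrite expf_neq0// andbT addrC natr1.
apply: nneseries_le_partial => [n|n].
  by rewrite !mulr_ge0// ?exprn_ge0// invr_ge0 exprn_ge0.
rewrite -mulr_sumr ler_wpM2l//; last exact: sum_inv_sqr.
by rewrite mulr_ge0// exprn_ge0.
Qed.
End crossing_moments.

Theorem corollary4p6 (R : realType) (d : measure_display)
    (T : measurableType d) (P : probability T R)
    (beta tau : nat -> {RV P >-> R}) (lambda alpha : R) (g : R -> R)
    (c C : nat -> {poly R})
    (beta_iid : iid P beta)
    (lambda_gt0 : 0 < lambda)
    (tau_poisson : poisson_field P lambda tau)
    (beta_tau_indep : independent_sequences P beta tau)
    (g_L1 : lebesgue_measure.-integrable [set: R] (EFin \o g))
    (g_smooth : smooth g)
    (alpha_gt0 : 0 < alpha)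
    (g_ninfty : forall k : nat, (1 <= k)%N ->
       equivalent_at -oo (g^`(k))%classic (fun t => (c k).[t] * expR (alpha * t)))
    (g_pinfty : forall k : nat, (1 <= k)%N ->
       equivalent_at +oo (g^`(k))%classic (fun t => (C k).[t] * expR (- alpha * t)))
    (alpha_lt_lambda : alpha < lambda)
    (beta_L1 : ('E_P[(fun w => `|beta 0%N w|%R)] < +oo)%E)
    (beta_g :
       has_bounded_density P (beta 0%N) \/
       ((\int[P]_w (`|beta 0%N w|%R%:E)^-1 < +oo)%E /\
        ((forall x : R, 0 < x -> (g^`())%classic x < 0) \/
         (forall x : R, 0 < x -> ((fun y => g (- y))^`())%classic x < 0)))) :
  forall (u : R) (I : set R) (p : R),
    is_interval I -> bounded_set I -> 1 <= p ->
    (\int[P]_w (crossings (shot_noise beta tau g) I u w `^ p) < +oo)%E.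
Proof.
move=> u I p _ bI p1.
have rate : alpha / 2 = 2 * (alpha / 4) by field.
have decay k : exists2 K : R, 0 <= K &
    forall t, `|g^`(k)%classic t| <= K * expR (- (2 * (alpha / 4)) * `|t|).
  by rewrite -rate; exact: (kernel_decay alpha_gt0 g_smooth g_L1 g_ninfty g_pinfty).
have fin : (\int[P]_w total_mark beta tau (alpha / 4) w < +oo)%E.
  by apply: (mean_total_mark lambda_gt0 beta_iid tau_poisson beta_tau_indep) => //; rewrite divr_gt0.
have [K0 _ gK0] := decay 0; rewrite derive1n0 in gK0.
have [K1 _ gK1] := decay 1; rewrite derive1n1 in gK1.
have [A0 _ [eta eta0 g_lower]] := deriv_lower g_pinfty.
have [Kb Kb0 beta_small] : exists2 K : R, 0 <= K & forall rho : R, 0 < rho ->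
    (P [set w | (`|beta 0%N w| <= rho)%R] <= (K * rho)%:E)%E.
  by apply: small_ball; case: beta_g => [|[]]; [left|right].
have dg x : derivable g x 1 by exact: (@g_smooth 0 x).
have [C0 C00 conc] := concentration lambda_gt0 beta_iid tau_poisson beta_tau_indep
  alpha_gt0 alpha_lt_lambda dg gK0 gK1 eta0 g_lower Kb0 beta_small fin u.
exact: (crossings_moment alpha_gt0 g_smooth decay fin C00 conc bI p1).
Qed.
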